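(* Let $M_1,M_2,M_3\in\mathbb{R}^{3\times 3}$ and let $0\le c_1<c_2<c_3\le 1$ be real nodes. Put $M=M_1+M_2+M_3$. Assume that the following six conditions hold. 1. $M_i=M_i^{\top}$ for $i=1,2,3$. 2. There is $\alpha\in\mathbb{R}$ such that $$\begin{bmatrix}1&\tfrac12&\tfrac13\\ \tfrac12&\tfrac13&\tfrac14\\ \tfrac13&\tfrac14&\alpha\end{bmatrix}M=I_3 .$$ 3. $$\begin{bmatrix}1&1&1\\0&-1&-2\\0&0&1\end{bmatrix}M_3\begin{bmatrix}1&0&0\\1&-1&0\\1&-2&1\end{bmatrix}=M_1 .$$ 4. $c_1+c_3=1$ and $c_2=\tfrac12$. 5. $$(c_1M_1+c_2M_2+c_3M_3)\begin{bmatrix}1\\ 1/2\\ 1/3\end{bmatrix}=\begin{bmatrix}0\\1\\0\end{bmatrix}.$$ 6. $$\begin{bmatrix}1&1/2&1/3\end{bmatrix}(c_1^2M_1+c_2^2M_2+c_3^2M_3)\begin{bmatrix}1\\ 1/2\\ 1/3\end{bmatrix}=\tfrac13 .$$ Then, when applied to Poisson systems $\dot y=S(y)\nabla H(y)$, $y(0)=y_0\in\mathbb{R}^d$, the 3-degree partitioned continuous-stage Runge--Kutta method $y_0\mapsto y_1$ determined by $M_1,M_2,M_3$ and $c_1,c_2,c_3$ is energy-preserving, symmetric, and of order at least $4$.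
   Context: **Poisson system.** A system of ODEs $\frac{\mathrm{d}}{\mathrm{d}t}y=S(y)\nabla H(y)$, $y(0)=y_0\in\mathbb{R}^d$, where $S:\mathbb{R}^d\to\mathbb{R}^{d\times d}$ takes skew-symmetric matrix values and $H:\mathbb{R}^d\to\mathbb{R}$ is the energy. Both $S$ and $H$ are assumed to be sufficiently regular (smooth). The Jacobi identity is not required. **3-degree PCSRK method.** Given $M_1,M_2,M_3\in\mathbb{R}^{3\times3}$ and distinct nodes $0\le c_1<c_2<c_3\le1$, define for $j=1,2,3$ the polynomials in $\tau,\zeta$ $$A_{\tau,j,\zeta}=\begin{bmatrix}\tau&\tfrac{\tau^2}{2}&\tfrac{\tau^3}{3}\end{bmatrix}M_j\begin{bmatrix}1\\ \zeta\\ \zeta^2\end{bmatrix},\qquad B_{j,\zeta}=A_{1,j,\zeta}.$$ For a step size $h$, let $Y_\tau$ ($\tau\in[0,1]$) be the $\mathbb{R}^d$-valued polynomial in $\tau$ (of degree at most $3$) and $y_1\in\mathbb{R}^d$ the vector satisfying $$Y_\tau=y_0+h\sum_{j=1}^3\int_0^1A_{\tau,j,\zeta}\,S(Y_{c_j})\nabla H(Y_\zeta)\,\mathrm{d}\zeta,\qquad y_1=y_0+h\sum_{j=1}^3\int_0^1B_{j,\zeta}\,S(Y_{c_j})\nabla H(Y_\zeta)\,\mathrm{d}\zeta .$$ (So $Y_0=y_0$ and $Y_1=y_1$.) As usual for implicit one-step methods, for $|h|$ sufficiently small $Y_\tau$ denotes the locally unique solution near $y_0$. The method is the one-step map $\Phi_h:y_0\mapsto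 y_1$. **Terminology (for all sufficiently small $|h|$).** - *Energy-preserving*: $H(y_1)=H(y_0)$. - *Symmetric*: $\Phi_h\circ\Phi_{-h}=\mathrm{id}$, i.e. the method equals its adjoint $\Phi_{-h}^{-1}$. - *Order at least $p$*: $y_1-y(h)=O(h^{p+1})$ as $h\to0$, where $y(\cdot)$ is the exact solution with $y(0)=y_0$, for all sufficiently regular $S$, $H$. *)

(* Defs.v *)
From mathcomp Require Import all_boot all_order all_algebra.
From mathcomp Require Import all_classical all_reals all_analysis.

Set Implicit Arguments.
Unset Strict Implicit.
Unset Printing Implicit Defensive.

Import Order.TTheory GRing.Theory Num.Theory.
Import numFieldNormedType.Exports.

Local Open Scope classical_set_scope.
Local Open Scope ring_scope.

Definition mx_of_seq (R : realType) (m n : nat) (s : seq (seq R)) :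
    'M[R]_(m, n) :=
  \matrix_(i < m, j < n) nth 0 (nth [::] s i) j.

Fixpoint class_C (R : realType) (V W : normedModType R) (k : nat) (f : V -> W) :
    Prop :=
  if k is k'.+1 then
    (forall x, differentiable f x) /\ (forall v, class_C k' ('D_v f))
  else continuous f.

Definition smooth (R : realType) (V W : normedModType R) (f : V -> W) : Prop :=
  forall k, class_C k f.

Section PoissonSystem.
Variables (R : realType) (d : nat).
Implicit Types (S : 'cV[R]_d -> 'M[R]_d) (H : 'cV[R]_d -> R).

Definition gradient H (y : 'cV[R]_d) : 'cV[R]_d :=
  \col_i 'D_(delta_mx i 0) H y.

Definition poisson_field S H (y : 'cV[R]_d) : 'cV[R]_d :=
  S y *m gradient H y.

Definition poisson_system S H : Prop :=
  [/\ smooth S, smooth H & forall y, (S y)^T = - S y].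

(* Local solutions suffice: the order of a method only involves small times. *)
Definition exact_solution S H (y0 : 'cV[R]_d) (y : R -> 'cV[R]_d) : Prop :=
  y 0 = y0 /\ \forall t \near (0 : R),
    is_derive (t : R) (1 : R) y (poisson_field S H (y t)).

Definition vintegral01 (F : R -> 'cV[R]_d) : 'cV[R]_d :=
  \col_i \int[lebesgue_measure]_(z in `[0, 1]) F z i 0.

Definition polyvec_eval (Y : 'cV[{poly R}]_d) (tau : R) : 'cV[R]_d :=
  \col_i (Y i 0).[tau].

End PoissonSystem.

Section Method.
Variable R : realType.
Implicit Types (M : 3.-tuple 'M[R]_3) (c : 3.-tuple R).

(* Component j : 'I_3 of the tuples is the coefficient of index j + 1. *)
Definition coefA M (j : 'I_3) (tau zeta : R) : R :=
  (mx_of_seq 1 3 [:: [:: tau; tau ^+ 2 / 2; tau ^+ 3 / 3]] *m tnth M j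
   *m mx_of_seq 3 1 [:: [:: 1]; [:: zeta]; [:: zeta ^+ 2]]) 0 0.

Definition coefB M (j : 'I_3) (zeta : R) : R := coefA M j 1 zeta.

Variable d : nat.
Variables (M : 3.-tuple 'M[R]_3) (c : 3.-tuple R).
Variables (S : 'cV[R]_d -> 'M[R]_d) (H : 'cV[R]_d -> R).
Implicit Types (h r : R).

Definition stage_eq h (y0 : 'cV[R]_d) (Y : 'cV[{poly R}]_d) : Prop :=
  (forall i, (size (Y i 0%R) <= 4)%N) /\
  forall tau, 0 <= tau <= 1 ->
    polyvec_eval Y tau =
      y0 + h *: \sum_(j < 3) vintegral01 (fun zeta =>
        coefA M j tau zeta *:
          (S (polyvec_eval Y (tnth c j)) *m gradient H (polyvec_eval Y zeta))).

Definition step_value h (y0 : 'cV[R]_d) (Y : 'cV[{poly R}]_d) : 'cV[R]_d :=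
  y0 + h *: \sum_(j < 3) vintegral01 (fun zeta =>
    coefB M j zeta *:
      (S (polyvec_eval Y (tnth c j)) *m gradient H (polyvec_eval Y zeta))).

Definition near_stage r h (y0 : 'cV[R]_d) (Y : 'cV[{poly R}]_d) : Prop :=
  stage_eq h y0 Y /\
  forall tau, 0 <= tau <= 1 -> `|polyvec_eval Y tau - y0| < r.

(* Phi h y is the y_1 of a step of size h from y.  The stage equation is
   implicit, so Phi is pinned down only for small h: around every point there
   is a radius r such that, for small h, the solution Y within distance r of
   the initial value is unique, and Phi is computed from that Y. The threshold
   on h is locally uniform in the initial value, which is what gives a meaning
   to compositions of steps. *)
Definition pcsrk_method (Phi : R -> 'cV[R]_d -> 'cV[R]_d) : Prop :=
  forall ybar : 'cV[R]_d, exists2 r : R, 0 < r &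
    \forall h \near (0 : R) & y0 \near ybar,
      exists Y, [/\ near_stage r h y0 Y,
        forall Z, near_stage r h y0 Z -> Z = Y &
        Phi h y0 = step_value h y0 Y].

End Method.

Section Terminology.
Variables (R : realType) (d : nat).
Implicit Types (S : 'cV[R]_d -> 'M[R]_d) (H : 'cV[R]_d -> R).
Implicit Types Phi : R -> 'cV[R]_d -> 'cV[R]_d.

Definition energy_preserving H Phi : Prop :=
  forall y0 : 'cV[R]_d, \forall h \near (0 : R), H (Phi h y0) = H y0.

(* An identity between maps, so the threshold on h is locally uniform. *)
Definition symmetric_method Phi : Prop :=
  forall ybar : 'cV[R]_d, \forall h \near (0 : R) & y0 \near ybar,
    Phi h (Phi (- h) y0) = y0.

Definition order_at_least (p : nat) S H Phi : Prop :=
  forall (y0 : 'cV[R]_d) (y : R -> 'cV[R]_d), exact_solution S H y0 y ->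
    (fun h : R => Phi h y0 - y h) =O_ (0 : R) (fun h : R => h ^+ p.+1).

End Terminology.

(* Main.v *)
(** Contracting the stage equation with the moments of [gradient H] along the
    stage polynomial turns one step into
      [Y_tau = y0 + h * sum_k A(tau; S_ik(Y), gradient_k H(Y))],
    where [A(tau; s, g)] is the bilinear form
      [sum_j \int A_{tau,j,zeta} s(c_j) g(zeta) dzeta].

    Energy is preserved because [H(Y_1) - H(Y_0)], written as the integral of
    [gradient H(Y) . Y'], pairs the symmetric matrices [M_j] with the skew
    matrices [S(Y_{c_j})].  Conditions 2-4 make [A] invariant under
    [tau -> 1 - tau] (condition 2 is what forces the invariance of [M_2]), so
    that [Y_{1 - tau}] solves the stage equation of the reversed step; it
    remains within the uniqueness radius because [Y_tau - y0 = O(h)], by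
    compactness of balls.

    For the order, compare [Y_tau] with [y(h tau)].  Since [A] is exact on
    [s^a t^b] for [a + b < 2], the error [e] improves from O(h) to O(h^3), and
    its leading term is [h^3] times a polynomial which is odd under
    [tau -> 1 - tau].  Inserting this once more, the odd term contributes
    nothing at [tau = 1], where [A] is exact on [s^a t^b] for [a + b < 4];
    hence [e(1) = O(h^5)]. *)

Require Import Defs.
From mathcomp Require Import all_boot all_order all_algebra.
From mathcomp Require Import all_classical all_reals all_analysis.
From mathcomp Require Import ring lra.
Set Implicit Arguments.
Unset Strict Implicit.
Unset Printing Implicit Defensive.
Import Order.TTheory GRing.Theory Num.Theory.
Import numFieldNormedType.Exports.
Local Open Scope ring_scope.

(** * Integrals over the unit interval *)

Lemma continuous_sum (R : realType) (T : topologicalType) (I : Type)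
    (s : seq I) (f : I -> T -> R) :
  (forall i, continuous (f i)) -> continuous (fun z => \sum_(i <- s) f i z).
Proof.
move=> cf; elim: s => [|i s IHs].
  by under eq_fun do rewrite big_nil; move=> x; exact: cvg_cst.
by under eq_fun do rewrite big_cons; move=> x; apply: cvgD; [exact: cf|exact: IHs].
Qed.

Lemma continuous_mulf (R : realType) (f g : R -> R) :
  continuous f -> continuous g -> continuous (fun z => f z * g z).
Proof. by move=> cf cg z; apply: cvgM; [exact: cf|exact: cg]. Qed.

Section UnitInterval.
Variable R : realType.
Implicit Types (f g F : R -> R) (C k : R).

Definition int01 f : R := \int[lebesgue_measure]_(z in `[0, 1]) f z.

Let measurable01 : measurable (`[0, 1]%classic : set R).
Proof. exact: measurable_itv. Qed.

Lemma integrable01 f : continuous f ->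
  lebesgue_measure.-integrable (`[0, 1]%classic : set R) (EFin \o f).
Proof.
move=> cf; apply: continuous_compact_integrable; first exact: segment_compact.
exact: continuous_subspaceT.
Qed.

Lemma eq_int01 f g : (forall z, 0 <= z <= 1 -> f z = g z) -> int01 f = int01 g.
Proof.
by move=> fg; apply: eq_Rintegral => z; rewrite inE/= in_itv/= => /fg.
Qed.

Lemma int01D f g : continuous f -> continuous g ->
  int01 (fun z => f z + g z) = int01 f + int01 g.
Proof. by move=> cf cg; apply: RintegralD => //; exact: integrable01. Qed.

Lemma int01B f g : continuous f -> continuous g ->
  int01 (fun z => f z - g z) = int01 f - int01 g.
Proof. by move=> cf cg; apply: RintegralB => //; exact: integrable01. Qed.

Lemma int01Z k f : continuous f -> int01 (fun z => k * f z) = k * int01 f.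
Proof. by move=> cf; apply: RintegralZl => //; exact: integrable01. Qed.

Lemma int01_cst k : int01 (cst k) = k.
Proof.
rewrite /int01 Rintegral_cst//.
have /= := @lebesgue_measure_itv R `[0, 1]; rewrite lte_fin ltr01 => ->.
by rewrite oppr0 adde0 mulr1.
Qed.

Lemma int01_sum (I : Type) (s : seq I) (f : I -> R -> R) :
  (forall i, continuous (f i)) ->
  int01 (fun z => \sum_(i <- s) f i z) = \sum_(i <- s) int01 (f i).
Proof.
move=> cf; elim: s => [|i s IHs].
  rewrite big_nil (_ : (fun _ => _) = cst 0) ?int01_cst//.
  by apply/funext => z; rewrite big_nil.
rewrite big_cons -IHs -int01D//.
  by apply: eq_int01 => z _; rewrite big_cons.
exact: continuous_sum.
Qed.

Lemma norm_int01_le f C : continuous f ->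
  (forall z, 0 <= z <= 1 -> `|f z| <= C) -> `|int01 f| <= C.
Proof.
move=> cf fC.
have le1 : `|int01 f| <= int01 (fun z => `|f z|).
  by apply: le_normr_Rintegral => //; exact: integrable01.
apply: (le_trans le1).
have cnf : continuous (fun z => `|f z|).
  by move=> x; apply: continuous_comp; [exact: cf | exact: norm_continuous].
rewrite -[leRHS]int01_cst; apply: le_Rintegral => //.
- exact: integrable01.
- by apply: integrable01 => x; exact: cvg_cst.
Qed.

Lemma int01_FTC F f : (forall x : R, is_derive x (1 : R) F (f x)) ->
  continuous f -> int01 f = F 1 - F 0.
Proof.
move=> dF cf.
have cF : continuous F.
  move=> x; apply: differentiable_continuous; apply/derivable1_diffP.
  by have := dF x => -[].
rewrite /int01 /Rintegral (@continuous_FTC2 R f F 0 1)//.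
- exact: continuous_subspaceT.
- split; first by move=> x _; have := dF x => -[].
  + by apply: cvg_within_filter; exact: cF.
  + by apply: cvg_within_filter; exact: cF.
- by move=> x _; rewrite derive1E; have := dF x => -[].
Qed.

Lemma int01X n : int01 (fun z => z ^+ n) = n.+1%:R^-1.
Proof.
pose F z : R := n.+1%:R^-1 * z ^+ n.+1.
have dF (x : R) : is_derive x (1 : R) F (x ^+ n).
  rewrite (_ : F = n.+1%:R^-1 \*: (@id R ^+ n.+1)); last first.
    by apply/funext => z; rewrite /F /GRing.scale/= exprfctE.
  apply: is_derive_eq; rewrite /GRing.scale/= mulr1 -mulr_natl mulrA.
  by rewrite mulVf ?mul1r// pnatr_eq0.
rewrite (int01_FTC dF); last exact: exprn_continuous.
by rewrite /F expr1n expr0n/= mulr0 subr0 mulr1.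
Qed.

Lemma int01_onem f : continuous f -> int01 (fun z => f (1 - z)) = int01 f.
Proof.
move=> cf; rewrite /int01 /Rintegral.
rewrite (@integration_by_substitution_onem R f 1) ?ler01 ?lexx//.
  by rewrite unstable.onem1.
exact: continuous_subspaceT.
Qed.

End UnitInterval.

(** * Smooth functions *)

Section ClassC.
Variables (R : realType) (V : normedModType R).
Implicit Types (f g : V -> R) (k : nat).

Lemma class_CW (W : normedModType R) k (f : V -> W) : class_C k.+1 f -> class_C k f.
Proof.
elim: k f => [f [df _] x|k IHk f [df cDf]].
  exact: differentiable_continuous.
by split=> // v; apply: IHk; exact: cDf.
Qed.

Lemma class_C_cst k (c : R) : class_C k (cst c : V -> R).
Proof.
elim: k c => [c x|k IHk c]; first exact: cvg_cst.
split=> [x|v]; first exact: differentiable_cst.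
rewrite (_ : 'D_v (cst c : V -> R) = cst 0); first exact: IHk.
by apply/funext => x; rewrite derive_cst.
Qed.

Lemma class_CD k f g : class_C k f -> class_C k g -> class_C k (fun x => f x + g x).
Proof.
elim: k f g => [f g cf cg x|k IHk f g [df cDf] [dg cDg]].
  by apply: cvgD; [exact: cf|exact: cg].
split=> [x|v]; first exact: differentiableD.
rewrite (_ : 'D_v _ = fun x => 'D_v f x + 'D_v g x).
  by apply: IHk; [exact: cDf|exact: cDg].
by apply/funext => x; rewrite deriveD//; exact: diff_derivable.
Qed.

(** The product rule leaves one factor undifferentiated in each term; [class_CW] lowers that factor
    to class [k] for the induction. *)
Lemma class_CM k f g : class_C k f -> class_C k g -> class_C k (fun x => f x * g x).
Proof.
elim: k f g => [f g cf cg x|k IHk f g Cf Cg].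
  by apply: cvgM; [exact: cf|exact: cg].
have [df cDf] := Cf; have [dg cDg] := Cg.
split=> [x|v]; first exact: differentiableM.
rewrite (_ : 'D_v _ = fun x => f x * 'D_v g x + g x * 'D_v f x).
  apply: class_CD; apply: IHk => //; by [exact: class_CW | exact: cDf | exact: cDg].
by apply/funext => x; rewrite deriveM//; exact: diff_derivable.
Qed.

Lemma class_C_sum k (I : Type) (s : seq I) (f : I -> V -> R) :
  (forall i, class_C k (f i)) -> class_C k (fun x => \sum_(i <- s) f i x).
Proof.
move=> Cf; elim: s => [|i s IHs].
  under eq_fun do rewrite big_nil; exact: class_C_cst.
by under eq_fun do rewrite big_cons; exact: class_CD.
Qed.

Lemma class_C_coord k m n (F : V -> 'M[R]_(m, n)) i j :
  class_C k F -> class_C k (fun x => F x i j).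
Proof.
elim: k F => [F cF x|k IHk F [dF cDF]].
  by apply: (@continuous_comp _ _ _ F (fun M : 'M[R]_(m, n) => M i j));
    [exact: cF|exact: coord_continuous].
split=> [x|v].
  apply: (@differentiable_comp _ _ _ _ F (fun M : 'M[R]_(m, n) => M i j)) => //.
  exact: differentiable_coord.
rewrite (_ : 'D_v _ = fun x => 'D_v F x i j).
  by apply: IHk; exact: cDF.
apply/funext => x; rewrite derive_mx ?mxE//.
exact: diff_derivable.
Qed.

End ClassC.

Section Smooth.
Variables (R : realType) (d : nat).
Local Notation V := 'cV[R]_d.
Implicit Types (f g : V -> R) (x y v : V).

Lemma smooth_differentiable (W : normedModType R) (f : V -> W) x :
  smooth f -> differentiable f x.
Proof. by move=> /(_ 1%N)[]. Qed.

Lemma smooth_continuous (W : normedModType R) (f : V -> W) : smooth f -> continuous f.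
Proof. by move=> /(_ 0%N). Qed.

Lemma smooth_derive (W : normedModType R) (f : V -> W) v : smooth f -> smooth ('D_v f).
Proof. by move=> sf k; have [_] := sf k.+1; apply. Qed.

Lemma smooth_gradient f i : smooth f -> smooth (fun x => gradient f x i 0).
Proof.
move=> sf; under eq_fun do rewrite mxE.
exact: smooth_derive.
Qed.

Lemma smoothM f g : smooth f -> smooth g -> smooth (fun x => f x * g x).
Proof. by move=> sf sg k; apply: class_CM. Qed.

Lemma smooth_sum (I : Type) (s : seq I) (f : I -> V -> R) :
  (forall i, smooth (f i)) -> smooth (fun x => \sum_(i <- s) f i x).
Proof. by move=> sf k; apply: class_C_sum => i; exact: sf. Qed.

Lemma smooth_coord m n (F : V -> 'M[R]_(m, n)) i j :
  smooth F -> smooth (fun x => F x i j).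
Proof. by move=> sF k; apply: class_C_coord. Qed.

Lemma derive_gradient f x v : differentiable f x ->
  'D_v f x = \sum_i v i 0 * gradient f x i 0.
Proof.
move=> df; rewrite deriveE//.
have ev : v = \sum_i v i 0 *: delta_mx i 0.
  by rewrite {1}[v]matrix_sum_delta; apply: eq_bigr => i _; rewrite big_ord1.
rewrite {1}ev linear_sum; apply: eq_bigr => i _.
by rewrite linearZ/= -deriveE// mxE.
Qed.

Lemma is_derive_comp_path f (y : R -> V) (t : R) v : differentiable f (y t) ->
  is_derive t (1 : R) y v ->
  is_derive t (1 : R) (f \o y) (\sum_i v i 0 * gradient f (y t) i 0).
Proof.
move=> df [dy <-].
have dy' : differentiable y t by exact/derivable1_diffP.
have dfy : differentiable (f \o y) t by exact: differentiable_comp.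
apply: DeriveDef; first exact: diff_derivable.
by rewrite deriveE// diff_comp//= -(deriveE _ dy') -(deriveE _ df) derive_gradient.
Qed.

(** The one-variable mean value theorem along the segment from [x] to [y]; a single intermediate
    point serves because [f] is scalar. *)
Lemma mean_value f x y : (forall z, differentiable f z) ->
  exists2 t : R, 0 <= t <= 1 &
    f y - f x = \sum_i (y - x) i 0 * gradient f (x + t *: (y - x)) i 0.
Proof.
move=> df; pose p (t : R) := x + t *: (y - x).
have dp (t : R) : is_derive t (1 : R) p (y - x).
  have dp : is_diff t p (0 + ( *:%R ^~ (y - x))).
    rewrite (_ : p = cst x + ( *:%R ^~ (y - x))); last by apply/funext => z.
    exact: is_diffD.
  apply: DeriveDef; first exact/diff_derivable/ex_diff.
  rewrite deriveE; last exact: ex_diff.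
  by rewrite diff_val/= add0r scale1r.
have dfp (t : R) := @is_derive_comp_path f p t (y - x) (df _) (dp t).
have cfp : {within `[0, 1]%classic, continuous (f \o p)}%classic.
  apply: continuous_subspaceT => t; apply: differentiable_continuous.
  by apply/derivable1_diffP; case: (dfp t).
have [t t01] := @MVT R (f \o p) _ 0 1 ltr01 (fun t _ => dfp t) cfp.
rewrite /p/= scale1r scale0r addr0 subrKC subr0 mulr1 => ->.
by exists t => //; move: t01; rewrite in_itv/= => /andP[t0 t1]; rewrite !ltW.
Qed.

Lemma norm_coord_le (m n : nat) (M : 'M[R]_(m, n)) i j : `|M i j| <= `|M|.
Proof.
rewrite [leRHS]mx_normrE.
exact: (le_bigmax _ (fun k : 'I_m * 'I_n => `|M k.1 k.2|) (i, j)).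
Qed.

Lemma norm_mx_le (m n : nat) (M : 'M[R]_(m, n)) C : 0 <= C ->
  (forall i j, `|M i j| <= C) -> `|M| <= C.
Proof. by move=> C0 MC; rewrite [leLHS]mx_normrE; apply: bigmax_le => // -[i j] _. Qed.

Lemma continuous_near_bounded (T : topologicalType) (f : T -> R) (x : T) :
  {for x, continuous f} -> \forall z \near x, `|f z| <= `|f x| + 1.
Proof.
move=> cf; have /cvgrPdist_lt/(_ 1 ltr01) := cf.
apply: filterS => z; rewrite distrC => fz.
rewrite -lerBlDl; apply: le_trans (ltW fz).
by rewrite lerBlDl addrC -lerBlDr lerB_dist.
Qed.

Lemma segmentE x y z (t : R) :
  y + t *: (z - y) - x = (1 - t) *: (y - x) + t *: (z - x).
Proof. by apply/matrixP => k l; rewrite !mxE; ring. Qed.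

Lemma near_segment x y z (t e : R) : 0 <= t <= 1 ->
  `|y - x| < e -> `|z - x| < e -> `|y + t *: (z - y) - x| < e.
Proof.
move=> /andP[t0 t1] yx zx; rewrite segmentE.
apply: le_lt_trans (ler_normD _ _) _; rewrite !normrZ !ger0_norm ?subr_ge0//.
have [->|t0'] := eqVneq t 0; first by rewrite subr0 mul1r mul0r addr0.
have {t0 t0'}t0 : 0 < t by rewrite lt_def t0' t0.
nra.
Qed.

(** Each component of the gradient is bounded near [x], and the intermediate point of the mean value
    theorem stays in the ball by convexity. *)
Lemma smooth_lipschitz f x : smooth f ->
  exists L e : R, [/\ 0 <= L, 0 < e & forall y z,
    `|y - x| < e -> `|z - x| < e -> `|f z - f y| <= L * `|z - y|].
Proof.
move=> sf.
pose B := \sum_i (`|gradient f x i 0| + 1).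
have B0 : 0 <= B by apply: sumr_ge0 => i _; rewrite addr_ge0.
have nB i : \forall z \near x, `|gradient f z i 0| <= `|gradient f x i 0| + 1.
  apply: continuous_near_bounded.
  exact: (smooth_continuous (smooth_gradient i sf)).
have [r /= r0 rP] := (nbhs_ballP _ _).1 (@filter_forall _ _ _ (nbhs x) _ nB).
exists B, r; split => // y z yx zx.
have [t t01 ->] := mean_value y z (fun z => smooth_differentiable z sf).
apply: le_trans (ler_norm_sum _ _ _) _.
rewrite /B mulr_suml; apply: ler_sum => i _; rewrite normrM mulrC.
apply: ler_pM => //; last exact: norm_coord_le.
apply: rP; rewrite -ball_normE/= distrC.
exact: near_segment.
Qed.

(** The gradient is frozen at [x] instead of [y]: the mean value theorem yields it at an
    intermediate point, and moving that point to [x] costs a Lipschitz factor. With [x = y0] the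
    linear part then has constant coefficients along both curves that are compared later. *)
Lemma taylor2 f x : smooth f ->
  exists L e : R, [/\ 0 <= L, 0 < e & forall y z,
    `|y - x| < e -> `|z - x| < e ->
    `|f z - f y - \sum_i (z - y) i 0 * gradient f x i 0|
      <= L * (`|y - x| + `|z - x|) * `|z - y|].
Proof.
move=> sf.
have /choice[L /choice[e LeP]] i := smooth_lipschitz x (smooth_gradient i sf).
have B0 : 0 <= \sum_i L i by apply: sumr_ge0 => i _; case: (LeP i).
have [e0 e0P] : exists2 e0, 0 < e0 & forall i, e0 <= e i.
  (* The minimum starts from 1, which keeps the common radius positive even when [d = 0]. *)
  exists (\big[Order.min/1]_i e i); last by move=> i; exact: bigmin_le_cond.
  by apply: lt_bigmin => // i _; case: (LeP i).
exists (\sum_i L i), e0; split=> // y z yx zx.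
have [t t01 ->] := mean_value y z (fun z => smooth_differentiable z sf).
rewrite -sumrB; apply: le_trans (ler_norm_sum _ _ _) _.
rewrite -mulrA mulr_suml; apply: ler_sum => i _.
rewrite -mulrBr normrM mulrC mulrA.
apply: ler_pM => //; last exact: norm_coord_le.
have [Li ei0 Hi] := LeP i.
have w : `|y + t *: (z - y) - x| < e i.
  by apply: lt_le_trans (near_segment t01 yx zx) _.
have := Hi x _ _ w; rewrite subrr normr0 => /(_ ei0)/le_trans; apply.
apply: ler_wpM2l => //; have /andP[t0 t1] := t01.
rewrite (segmentE x y z t); apply: le_trans (ler_normD _ _) _.
rewrite !normrZ !ger0_norm ?subr_ge0//; apply: lerD.
  by rewrite ler_piMl// gerBl.
by rewrite ler_piMl.
Qed.

End Smooth.

(** * Remainders that are uniform in the stage parameter *)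

Lemma near0_lt (R : realType) (e : R) : 0 < e -> \forall h \near (0 : R), `|h| < e.
Proof.
move=> e0; apply/nbhs_ballP; exists e => // h.
by rewrite -ball_normE/= sub0r normrN.
Qed.

Section UniformBigO.
Variable R : realType.
Implicit Types (u v : R -> R -> R) (k l N : nat).

(** The bound is uniform in [tau], so that it survives evaluation at the nodes and integration over
    the unit interval. A function of [h] alone is treated as constant in [tau]. *)
Definition bigO01 k u : Prop :=
  exists2 C : R, 0 <= C & \forall h \near (0 : R),
    forall tau, 0 <= tau <= 1 -> `|u h tau| <= C * `|h| ^+ k.

Lemma bigO01_near_eq k u v :
  (\forall h \near (0 : R), forall tau, 0 <= tau <= 1 -> u h tau = v h tau) ->
  bigO01 k u -> bigO01 k v.
Proof.
move=> uv [C C0 uC]; exists C => //.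
near=> h => tau tau01; rewrite -(near uv h)//; exact: (near uC h).
Unshelve. all: by end_near. Qed.

Lemma bigO01_eq k u v : (forall h tau, u h tau = v h tau) -> bigO01 k u -> bigO01 k v.
Proof.
move=> uv [C C0 uC]; exists C => //; near=> h => tau tau01.
by rewrite -uv; exact: (near uC h).
Unshelve. all: by end_near. Qed.

Lemma bigO01D k u v : bigO01 k u -> bigO01 k v ->
  bigO01 k (fun h tau => u h tau + v h tau).
Proof.
move=> [C C0 uC] [D D0 vD]; exists (C + D); first exact: addr_ge0.
near=> h => tau tau01; apply: le_trans (ler_normD _ _) _; rewrite mulrDl.
by apply: lerD; [apply: (near uC)|apply: (near vD)].
Unshelve. all: by end_near. Qed.

Lemma bigO01N k u : bigO01 k u -> bigO01 k (fun h tau => - u h tau).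
Proof.
move=> [C C0 uC]; exists C => //.
near=> h => tau tau01; rewrite normrN; exact: (near uC h).
Unshelve. all: by end_near. Qed.

Lemma bigO01B k u v : bigO01 k u -> bigO01 k v ->
  bigO01 k (fun h tau => u h tau - v h tau).
Proof. by move=> uO /bigO01N; exact: bigO01D. Qed.

Lemma bigO01M k l u v : bigO01 k u -> bigO01 l v ->
  bigO01 (k + l) (fun h tau => u h tau * v h tau).
Proof.
move=> [C C0 uC] [D D0 vD]; exists (C * D); first exact: mulr_ge0.
near=> h => tau tau01; rewrite normrM exprD mulrACA.
by apply: ler_pM => //; [apply: (near uC)|apply: (near vD)].
Unshelve. all: by end_near. Qed.

Lemma bigO01W k l u : (k <= l)%N -> bigO01 l u -> bigO01 k u.
Proof.
move=> kl [C C0 uC]; exists C => //.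
near=> h => tau tau01; apply: le_trans (near uC h _ tau tau01) _ => //.
apply: ler_wpM2l => //; rewrite -(subnK kl) exprD ler_piMl ?exprn_ge0//.
apply: exprn_ile1 => //; near: h; exact: nbhs0_le.
Unshelve. all: by end_near. Qed.

Lemma bigO01_cst0 k : bigO01 k (fun _ _ => 0).
Proof.
exists 0 => //; near=> h => tau _; by rewrite normr0 mul0r.
Unshelve. all: by end_near. Qed.

Lemma bigO01_sum k (I : Type) (s : seq I) (P : pred I) (u : I -> R -> R -> R) :
  (forall i, P i -> bigO01 k (u i)) ->
  bigO01 k (fun h tau => \sum_(i <- s | P i) u i h tau).
Proof.
move=> uO; elim: s => [|i s IHs].
  by apply: bigO01_eq (bigO01_cst0 k) => h tau; rewrite big_nil.
have [Pi|/negbTE Pi] := boolP (P i).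
  by apply: bigO01_eq (bigO01D (uO i Pi) IHs) => h tau; rewrite big_cons Pi.
by apply: bigO01_eq IHs => h tau; rewrite big_cons Pi.
Qed.

Lemma continuous_bounded01 (f : R -> R) : continuous f ->
  exists2 C, 0 <= C & forall tau, 0 <= tau <= 1 -> `|f tau| <= C.
Proof.
move=> cf.
have cnf : {within `[0, 1]%classic, continuous (fun z => `|f z|)}%classic.
  apply: continuous_subspaceT => x.
  by apply: continuous_comp; [exact: cf | exact: norm_continuous].
have [c c01 cP] := EVT_max ler01 cnf.
by exists `|f c| => // tau tau01; apply: cP; rewrite in_itv.
Qed.

Lemma bigO01_continuous (f : R -> R) : continuous f -> bigO01 0 (fun _ => f).
Proof.
move=> /continuous_bounded01[C C0 fC]; exists C => //.
by near=> h => tau tau01; rewrite expr0 mulr1 fC.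
Unshelve. all: by end_near.
Qed.

Lemma bigO01_cst (c : R) : bigO01 0 (fun _ _ => c).
Proof. by apply: bigO01_continuous; exact: cst_continuous. Qed.

Lemma bigO01_exp k : bigO01 k (fun h _ => h ^+ k).
Proof.
by exists 1 => //; near=> h => tau _; rewrite normrX mul1r.
Unshelve. all: by end_near. Qed.

Lemma bigO01_hM k l u : bigO01 l u -> bigO01 (k + l) (fun h tau => h ^+ k * u h tau).
Proof. by apply: bigO01M; exact: bigO01_exp. Qed.

Lemma bigO01_at k u (c : R) : 0 <= c <= 1 -> bigO01 k u -> bigO01 k (fun h _ => u h c).
Proof.
move=> c01 [C C0 uC]; exists C => //.
near=> h => tau _; exact: (near uC h).
Unshelve. all: by end_near. Qed.

Lemma bigO01_int k u : (forall h, continuous (u h)) -> bigO01 k u ->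
  bigO01 k (fun h _ => int01 (u h)).
Proof.
move=> cu [C C0 uC]; exists C => //.
near=> h => tau _; apply: norm_int01_le => // z z01; exact: (near uC).
Unshelve. all: by end_near. Qed.

(** Since [|h * tau| <= |h|], an estimate near 0 also applies at time [h * tau]. This carries
    estimates along the exact solution to all stage parameters. *)
Lemma bigO01_scale k (u : R -> R) : bigO01 k (fun h _ => u h) ->
  bigO01 k (fun h tau => u (h * tau)).
Proof.
move=> [C C0 uC]; exists C => //.
have [e /= e0 eP] := (nbhs_ballP _ _).1 uC.
near=> h => tau /andP[tau0 tau1].
have htau : `|h * tau| <= `|h| by rewrite normrM ler_piMr// ger0_norm.
have he : `|h| < e by near: h; exact: near0_lt.
apply: (@le_trans _ _ (C * `|h * tau| ^+ k)).
  apply: (eP _ _ tau); last by rewrite tau0.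
  by rewrite -ball_normE/= sub0r normrN; exact: le_lt_trans he.
by apply: ler_wpM2l => //; rewrite lerXn2r// nnegrE.
Unshelve. all: by end_near. Qed.

(** As [u] vanishes at 0, the mean value theorem gives [u h = du t * h] with [|t| <= |h|], which
    gains one power of [h]. *)
Lemma bigO01_primitive k (u du : R -> R) :
  (\forall t \near (0 : R), is_derive t (1 : R) u (du t)) -> u 0 = 0 ->
  bigO01 k (fun h _ => du h) -> bigO01 k.+1 (fun h _ => u h).
Proof.
move=> ddu u0 [C C0 duC]; exists C => //.
have /nbhs_ballP[e /= e0 eP] : \forall t \near (0 : R),
    is_derive t (1 : R) u (du t) /\ `|du t| <= C * `|t| ^+ k.
  near=> t; split; first exact: (near ddu).
  by apply: (near duC t _ 0); rewrite ?lexx ?ler01.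
near=> h => _ _.
have he : `|h| < e by near: h; exact: near0_lt.
have eP' t : `|t| <= `|h| -> is_derive t (1 : R) u (du t) /\ `|du t| <= C * `|t| ^+ k.
  move=> th; apply: eP; rewrite -ball_normE/= sub0r normrN.
  exact: le_lt_trans he.
have cu t : `|t| <= `|h| -> {for t, continuous u}.
  move=> /eP'[[du' _] _]; apply: differentiable_continuous.
  exact/derivable1_diffP.
(* The sign of [h] decides which end of the interval is 0. *)
have [t th ->] : exists2 t, `|t| <= `|h| & u h = du t * h.
  have [h0|h0|->] := ltgtP h 0; last by exists 0; rewrite ?normr0// mulr0.
  - have [||t] := @MVT R u du h 0 h0.
    + by move=> t; rewrite in_itv/= => /andP[? ?]; apply: (eP' _ _).1; rewrite !ltr0_norm ?lerN2 ?ltW//.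
    + apply: continuous_in_subspaceT => t; rewrite inE/= in_itv/= => /andP[ht t0].
      by apply: cu; rewrite !ler0_norm ?lerN2// ltW.
    + rewrite in_itv/= => /andP[ht t0]; rewrite u0 !sub0r mulrN => /oppr_inj ->.
      by exists t => //; rewrite !ltr0_norm ?lerN2 ?ltW.
  - have [||t] := @MVT R u du 0 h h0.
    + by move=> t; rewrite in_itv/= => /andP[? ?]; apply: (eP' _ _).1; rewrite !gtr0_norm ?ltW//.
    + apply: continuous_in_subspaceT => t; rewrite inE/= in_itv/= => /andP[t0 ht].
      by apply: cu; rewrite !ger0_norm// ltW.
    + rewrite in_itv/= => /andP[t0 ht]; rewrite u0 !subr0 => ->.
      by exists t => //; rewrite !gtr0_norm ?ltW.
rewrite normrM exprSr mulrA ler_wpM2r//.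
apply: le_trans (eP' t th).2 _; apply: ler_wpM2l => //.
by rewrite lerXn2r// nnegrE.
Unshelve. all: by end_near. Qed.

End UniformBigO.

(** * Expansions in powers of the step size *)

Section Expansion.
Variable R : realType.
Implicit Types (u v : R -> R -> R) (a b : nat -> R -> R) (N : nat).

Definition expands N u a : Prop :=
  bigO01 N (fun h tau => u h tau - \sum_(n < N) h ^+ n * a n tau).

Lemma expands_sum0 N a : (forall n, bigO01 0 (fun _ => a n)) ->
  bigO01 0 (fun h tau => \sum_(n < N) h ^+ n * a n tau).
Proof.
move=> aO; apply: bigO01_sum => n _.
by apply: (@bigO01W _ _ (n + 0)) => //; exact: bigO01_hM.
Qed.

(** With [A] and [B] the truncated sums, [u v - A B = (u - A) v + A (v - B)], and the terms of [A B]
    with [i + j >= N] are themselves O(h^N). *)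
Lemma expandsM N u v a b :
  (forall n, bigO01 0 (fun _ => a n)) -> (forall n, bigO01 0 (fun _ => b n)) ->
  expands N u a -> expands N v b ->
  bigO01 N (fun h tau => u h tau * v h tau -
    \sum_(i < N) \sum_(j < N | (i + j < N)%N) h ^+ (i + j) * (a i tau * b j tau)).
Proof.
move=> aO bO ua vb.
set A := fun h tau => \sum_(n < N) h ^+ n * a n tau.
set B := fun h tau => \sum_(n < N) h ^+ n * b n tau.
have AO : bigO01 0 A by exact: expands_sum0.
have BO : bigO01 0 B by exact: expands_sum0.
have vO : bigO01 0 v.
  apply: (@bigO01_eq _ _ (fun h tau => (v h tau - B h tau) + B h tau)).
    by move=> h tau; rewrite subrK.
  by apply: bigO01D => //; apply: bigO01W vb.
have ABO : bigO01 N (fun h tau => \sum_(i < N) \sum_(j < N | ~~ (i + j < N)%N)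
    h ^+ (i + j) * (a i tau * b j tau)).
  apply: bigO01_sum => i _; apply: bigO01_sum => j; rewrite -leqNgt => Nij.
  apply: (@bigO01W _ _ (i + j + 0)); first by rewrite addn0.
  by apply: bigO01_hM; apply: (bigO01M (aO i) (bO j)).
have uO := bigO01M ua vO; rewrite addn0 in uO.
apply: bigO01_eq (bigO01D (bigO01D uO (bigO01M AO vb)) ABO) => h tau.
rewrite -/(A h tau) -/(B h tau).
have -> : \sum_(i < N) \sum_(j < N | ~~ (i + j < N)%N) h ^+ (i + j) * (a i tau * b j tau)
   = A h tau * B h tau -
    \sum_(i < N) \sum_(j < N | (i + j < N)%N) h ^+ (i + j) * (a i tau * b j tau).
  rewrite /A /B mulr_suml -sumrB; apply: eq_bigr => i _.
  rewrite mulr_sumr (bigID (fun j : 'I_N => (i + j < N)%N) predT)/=.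
  rewrite addrAC -sumrB [X in X + _]big1 ?add0r => [|j _]; last by rewrite exprD; ring.
  apply: eq_bigr => j _; rewrite exprD; ring.
ring.
Qed.

Lemma expands_at N u a (c : R) : 0 <= c <= 1 -> expands N u a ->
  expands N (fun h _ => u h c) (fun n _ => a n c).
Proof. by move=> c01; exact: bigO01_at. Qed.

Lemma expands_int N u a (w : R -> R) : continuous w ->
  (forall h, continuous (u h)) -> (forall n, continuous (a n)) ->
  expands N u a ->
  expands N (fun h _ => int01 (fun z => w z * u h z))
            (fun n _ => int01 (fun z => w z * a n z)).
Proof.
move=> cw cu ca ua.
have cM (f : R -> R) : continuous f -> continuous (fun z => w z * f z).
  by move=> cf x; apply: cvgM; [exact: cw|exact: cf].
have csum h : continuous (fun z => \sum_(n < N) h ^+ n * a n z).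
  by apply: continuous_sum => n x; apply: cvgM; [exact: cvg_cst|exact: ca].
have := bigO01M (bigO01_continuous cw) ua; rewrite add0n.
move=> /(bigO01_int _) H.
apply: bigO01_eq (H _) => [h tau|h]; last first.
  apply: cM => x; apply: cvgB; [exact: cu|exact: csum].
transitivity (int01 (fun z => w z * u h z - \sum_(n < N) h ^+ n * (w z * a n z))).
  apply: eq_int01 => z _; rewrite mulrBr mulr_sumr; congr (_ - _).
  by apply: eq_bigr => n _; rewrite mulrCA.
rewrite int01B; last 2 first.
- exact: cM.
- apply: continuous_sum => n x; apply: cvgM; [exact: cvg_cst|exact: cM].
rewrite int01_sum; last by move=> n x; apply: cvgM; [exact: cvg_cst|exact: cM].
by congr (_ - _); apply: eq_bigr => n _; rewrite int01Z//; exact: cM.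
Qed.

End Expansion.

(** * The bilinear form of the method *)

Lemma exchange_sum3 (R : nmodType) (I J K : finType) (P : J -> pred K)
    (F : I -> J -> K -> R) :
  \sum_i \sum_j \sum_(k | P j k) F i j k = \sum_j \sum_(k | P j k) \sum_i F i j k.
Proof. by rewrite exchange_big/=; apply: eq_bigr => j _; rewrite exchange_big. Qed.

Section Aform.
Variables (R : realType) (M : 3.-tuple 'M[R]_3) (c : 3.-tuple R).
Hypothesis c01 : forall j, 0 <= tnth c j <= 1.
Implicit Types (s g : R -> R).

(** The kernel [coefA] is expanded in monomials, so that [s] enters only through its values at the
    nodes and [g] only through its first three moments. *)
Definition Aform (tau : R) s g : R :=
  \sum_(j < 3) \sum_(p < 3) \sum_(q < 3) tau ^+ p.+1 / p.+1%:R * tnth M j p q *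
    (s (tnth c j) * int01 (fun z => z ^+ q * g z)).

(** The subtracted term is the integral of [z^a z^b] from 0 to [tau], which the exact solution has
    in place of the bilinear form. *)
Definition Aform_defect (a b : nat) (tau : R) : R :=
  Aform tau (fun z => z ^+ a) (fun z => z ^+ b) - tau ^+ (a + b).+1 / (a + b).+1%:R.

Lemma AformZ tau k l s g : continuous g ->
  Aform tau (fun z => k * s z) (fun z => l * g z) = k * l * Aform tau s g.
Proof.
move=> cg; rewrite /Aform mulr_sumr; apply: eq_bigr => j _.
rewrite mulr_sumr; apply: eq_bigr => p _; rewrite mulr_sumr; apply: eq_bigr => q _.
rewrite (_ : int01 _ = l * int01 (fun z => z ^+ q * g z)); first by ring.
rewrite -int01Z; first by apply: eq_int01 => z _; rewrite mulrCA.
by move=> x; apply: cvgM; [exact: exprn_continuous|exact: cg].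
Qed.

Lemma AformDl tau s t g : Aform tau (fun z => s z + t z) g = Aform tau s g + Aform tau t g.
Proof.
rewrite /Aform -big_split; apply: eq_bigr => j _.
rewrite -big_split; apply: eq_bigr => p _; rewrite -big_split; apply: eq_bigr => q _.
by rewrite /= -mulrDr -mulrDl.
Qed.

Lemma AformDr tau s f g : continuous f -> continuous g ->
  Aform tau s (fun z => f z + g z) = Aform tau s f + Aform tau s g.
Proof.
move=> cf cg; rewrite /Aform -big_split; apply: eq_bigr => j _.
rewrite -big_split; apply: eq_bigr => p _; rewrite -big_split; apply: eq_bigr => q _.
rewrite /= -mulrDr -mulrDr; congr (_ * (_ * _)).
rewrite -int01D; first by apply: eq_int01 => z _; rewrite mulrDr.
- by move=> x; apply: cvgM; [exact: exprn_continuous|exact: cf].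
- by move=> x; apply: cvgM; [exact: exprn_continuous|exact: cg].
Qed.

Lemma Aform_continuous s g : continuous (fun tau => Aform tau s g).
Proof.
apply: continuous_sum => j; apply: continuous_sum => p; apply: continuous_sum => q.
move=> x; apply: cvgM; last exact: cvg_cst.
apply: cvgM; last exact: cvg_cst.
by apply: cvgM; [exact: exprn_continuous|exact: cvg_cst].
Qed.

(** Each summand is a bounded weight in [tau] times a nodal value times a moment; both of the latter
    inherit expansions, and [expandsM] multiplies them. *)
Lemma Aform_expand N (s g : R -> R -> R) (a b : nat -> R -> R) :
  (forall h, continuous (g h)) -> (forall n, continuous (b n)) ->
  expands N s a -> expands N g b ->
  bigO01 N (fun h tau => Aform tau (s h) (g h) -
    \sum_(i < N) \sum_(j < N | (i + j < N)%N) h ^+ (i + j) * Aform tau (a i) (b j)).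
Proof.
move=> cg cb sa gb.
pose t (j p q : 'I_3) h tau : R := tau ^+ p.+1 / p.+1%:R * tnth M j p q *
  (s h (tnth c j) * int01 (fun z => z ^+ q * g h z) -
   \sum_(k < N) \sum_(l < N | (k + l < N)%N)
     h ^+ (k + l) * (a k (tnth c j) * int01 (fun z => z ^+ q * b l z))).
have tO j p q : bigO01 N (t j p q).
  have w0 : bigO01 0 (fun _ tau => tau ^+ p.+1 / p.+1%:R * tnth M j p q).
    apply: bigO01_continuous => x; apply: cvgM; last exact: cvg_cst.
    by apply: cvgM; [exact: exprn_continuous|exact: cvg_cst].
  apply: (bigO01M w0); apply: (@expandsM _ N (fun h _ => s h (tnth c j))
    (fun h _ => int01 (fun z => z ^+ q * g h z)) (fun k _ => a k (tnth c j))
    (fun l _ => int01 (fun z => z ^+ q * b l z))).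
  - by move=> n; exact: bigO01_cst.
  - by move=> n; exact: bigO01_cst.
  - by apply: expands_at.
  - by apply: expands_int => //; exact: exprn_continuous.
apply: (@bigO01_eq _ _ (fun h tau => \sum_(j < 3) \sum_(p < 3) \sum_(q < 3) t j p q h tau)).
  move=> h tau; rewrite /t /Aform.
  under eq_bigr do under eq_bigr do under eq_bigr do rewrite mulrBr.
  under eq_bigr do under eq_bigr do rewrite sumrB.
  under eq_bigr do rewrite sumrB.
  rewrite sumrB; congr (_ - _).
  (* The expansion indices [k] and [l] are moved outside the sums over [j], [p] and [q]. *)
  under eq_bigr do under eq_bigr do under eq_bigr do
    (rewrite mulr_sumr; under eq_bigr do rewrite mulr_sumr).
  under eq_bigr do under eq_bigr do rewrite exchange_sum3.
  under eq_bigr do rewrite exchange_sum3.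
  rewrite exchange_sum3; apply: eq_bigr => k _; apply: eq_bigr => l _.
  rewrite mulr_sumr; apply: eq_bigr => j _; rewrite mulr_sumr; apply: eq_bigr => p _.
  rewrite mulr_sumr; apply: eq_bigr => q _; ring.
by apply: bigO01_sum => j _; apply: bigO01_sum => p _; apply: bigO01_sum => q _.
Qed.

End Aform.

(** * Taylor expansions along the exact solution *)

Section ExactSolution.
Variables (R : realType) (d : nat) (S : 'cV[R]_d -> 'M[R]_d) (H : 'cV[R]_d -> R).
Hypothesis SH : poisson_system S H.
Variables (y0 : 'cV[R]_d) (y : R -> 'cV[R]_d).
Hypothesis yP : exact_solution S H y0 y.
Implicit Types phi : 'cV[R]_d -> R.

(* The derivative of [phi] along the Poisson field: iterating it gives the
   derivatives of [phi] along the exact solution. *)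
Definition lie phi (z : 'cV[R]_d) : R :=
  \sum_i (poisson_field S H z) i 0 * gradient phi z i 0.

Let sS i k : smooth (fun z => S z i k).
Proof. by case: SH => sS _ _; exact: smooth_coord. Qed.

Let sg k : smooth (fun z => gradient H z k 0).
Proof. by case: SH => _ sH _; exact: smooth_gradient. Qed.

Lemma smooth_lie phi : smooth phi -> smooth (lie phi).
Proof.
move=> sphi; apply: smooth_sum => i; apply: smoothM; last exact: smooth_gradient.
under eq_fun do rewrite /poisson_field mxE.
by apply: smooth_sum => k; apply: smoothM.
Qed.

Let y00 : y 0 = y0. Proof. by case: yP. Qed.

Let near_derive phi : smooth phi ->
  \forall t \near (0 : R), is_derive t (1 : R) (phi \o y) (lie phi (y t)).
Proof.
move=> sphi; case: yP => _ dy; near=> t.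
apply: is_derive_comp_path; last exact: (near dy t).
exact: smooth_differentiable.
Unshelve. all: by end_near. Qed.

Definition taylor_coef phi n : R := iter n lie phi y0 / n`!%:R.

(** Induction on [N]: the derivative of the remainder of [phi] at order [N + 1] is the remainder of
    [lie phi] at order [N], and [bigO01_primitive] recovers the missing power. The base case is
    boundedness near 0. *)
Lemma taylor_along phi N : smooth phi ->
  bigO01 N (fun h _ => phi (y h) - \sum_(n < N) taylor_coef phi n * h ^+ n).
Proof.
elim: N phi => [|N IHN] phi sphi.
  have cphi : {for 0 : R, continuous (phi \o y)}.
    apply: differentiable_continuous; apply/derivable1_diffP.
    by case: (nbhs_singleton (near_derive sphi)).
  exists (`|phi (y 0)| + 1); first exact: addr_ge0.
  have := continuous_near_bounded cphi; apply: filterS => h hb tau _.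
  by rewrite big_ord0 subr0 expr0 mulr1.
pose du h := lie phi (y h) - \sum_(n < N) taylor_coef (lie phi) n * h ^+ n.
apply: (@bigO01_primitive _ _ _ du); last exact/IHN/smooth_lie.
  have := near_derive sphi; apply: filterS => t dphi.
  rewrite /du; apply: (@is_deriveB _ _ _ (phi \o y)
    (fun h => \sum_(n < N.+1) taylor_coef phi n * h ^+ n)).
  rewrite (_ : (fun h => _) = \sum_(n < N.+1) (taylor_coef phi n \*: (@id R ^+ n))); last first.
    by apply/funext => h; rewrite fct_sumE; apply: eq_bigr => n _; rewrite exprfctE.
  apply: is_derive_eq; rewrite big_ord_recl/= mul0r [0%:A]scale0r scaler0 add0r.
  apply: eq_bigr => n _; rewrite /taylor_coef /bump leq0n add1n add0n iterSr.
  rewrite factS natrM /GRing.scale/= mulr1.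
  have n1 : n.+1%:R != 0 :> R by rewrite pnatr_eq0.
  have nf : n`!%:R != 0 :> R by rewrite pnatr_eq0 -lt0n fact_gt0.
  move: (n.+1%:R : R) (n`!%:R : R) n1 nf => k l k0 l0.
  by field; rewrite k0 l0.
rewrite y00 big_ord_recl big1 ?addr0.
  by rewrite /taylor_coef/= expr0 mulr1 divr1 subrr.
by move=> i _; rewrite expr0n/= mulr0.
Qed.

End ExactSolution.

(** * Comparison, smallness and vector norms of remainders *)

Section MoreBigO.
Variable R : realType.
Implicit Types (u v : R -> R -> R).

Lemma bigO01_le k u v :
  (\forall h \near (0 : R), forall tau, 0 <= tau <= 1 -> `|u h tau| <= `|v h tau|) ->
  bigO01 k v -> bigO01 k u.
Proof.
move=> uv [C C0 vC]; exists C => //; near=> h => tau tau01.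
by apply: le_trans (near uv h _ tau tau01) _ => //; exact: (near vC h).
Unshelve. all: by end_near. Qed.

Lemma bigO01_norm k u : bigO01 k u -> bigO01 k (fun h tau => `|u h tau|).
Proof. by apply: bigO01_le; near=> h => tau _; rewrite normr_id.
Unshelve. all: by end_near. Qed.

Lemma bigO01_small k u (e : R) : bigO01 k.+1 u -> 0 < e ->
  \forall h \near (0 : R), forall tau, 0 <= tau <= 1 -> `|u h tau| < e.
Proof.
move=> /(@bigO01W _ 1 k.+1 _ isT)[C C0 uC] e0.
(* [C] may be 0, hence the denominator [C + 1]. *)
have D0 : 0 < e / (C + 1) by rewrite divr_gt0// ltr_wpDl.
near=> h => tau tau01; apply: le_lt_trans (near uC h _ tau tau01) _ => //.
have hD : `|h| < e / (C + 1) by near: h; exact: near0_lt.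
rewrite expr1; apply: (@le_lt_trans _ _ ((C + 1) * `|h|)).
  by rewrite ler_wpM2r// lerDl.
by rewrite mulrC -ltr_pdivlMr// ltr_wpDl.
Unshelve. all: by end_near. Qed.

Lemma norm_cV_le_sum d (v : 'cV[R]_d) : `|v| <= \sum_i `|v i 0|.
Proof.
apply: norm_mx_le; first exact: sumr_ge0.
by move=> i j; rewrite ord1 (bigD1 i)//= lerDl sumr_ge0.
Qed.

Lemma bigO01_cV k d (v : R -> R -> 'cV[R]_d) :
  (forall i, bigO01 k (fun h tau => v h tau i 0)) ->
  bigO01 k (fun h tau => `|v h tau|).
Proof.
move=> vO; apply: (@bigO01_le _ _ (fun h tau => \sum_i `|v h tau i 0|)).
  near=> h => tau _; rewrite normr_id ger0_norm ?sumr_ge0//.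
  exact: norm_cV_le_sum.
by apply: bigO01_sum => i _; exact: bigO01_norm.
Unshelve. all: by end_near. Qed.

End MoreBigO.

Section Coordinate.
Variables (R : realType) (d : nat).

Lemma derive_coord (i : 'I_d) (z v : 'cV[R]_d) : 'D_v (fun z : 'cV[R]_d => z i 0) z = v i 0.
Proof.
have did : derivable (@id 'cV[R]_d) z v by exact: derivable_id.
have := derive_mx did; rewrite derive_id => /matrixP/(_ i 0) ->.
by rewrite mxE.
Qed.

End Coordinate.

Lemma is_derive_bigsum (R : realType) (I : Type) (s : seq I) (P : pred I)
    (f : I -> R -> R) (df : I -> R) (t : R) :
  (forall i, P i -> is_derive t (1 : R) (f i) (df i)) ->
  is_derive t (1 : R) (fun h => \sum_(i <- s | P i) f i h) (\sum_(i <- s | P i) df i).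
Proof.
move=> dfi; elim: s => [|i s IHs].
  rewrite big_nil; under eq_fun do rewrite big_nil; exact: is_derive_cst.
rewrite big_cons; under eq_fun do rewrite big_cons.
by case: ifP => // Pi; apply: is_deriveD; exact: dfi.
Qed.

Lemma is_derive_monomial (R : realType) n (k t : R) :
  is_derive t (1 : R) (fun h => h ^+ n.+1 * (k / n.+1%:R)) (t ^+ n * k).
Proof.
rewrite (_ : (fun h => _) = (k / n.+1%:R) \*: (@id R ^+ n.+1)); last first.
  by apply/funext => h; rewrite /GRing.scale/= exprfctE mulrC.
apply: is_derive_eq; rewrite /GRing.scale/= mulr1.
have : n.+1%:R != 0 :> R by rewrite pnatr_eq0.
by move: (n.+1%:R : R) => l l0; field.
Qed.

(** * The local error *)

Section LocalError.
Variables (R : realType) (d : nat) (S : 'cV[R]_d -> 'M[R]_d) (H : 'cV[R]_d -> R).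
Hypothesis SH : poisson_system S H.
Variables (y0 : 'cV[R]_d) (y : R -> 'cV[R]_d).
Hypothesis yP : exact_solution S H y0 y.
Implicit Types phi : 'cV[R]_d -> R.

Let Sf i k := fun z => S z i k.
Let gf k := fun z => gradient H z k 0.
Let T phi n := taylor_coef S H y0 phi n.

Let sS i k : smooth (Sf i k).
Proof. by case: SH => sS _ _; exact: smooth_coord. Qed.

Let sg k : smooth (gf k).
Proof. by case: SH => _ sH _; exact: smooth_gradient. Qed.

(** The Taylor expansions of the entries of [S] and of the gradient are multiplied and integrated
    term by term. The result has the shape of the expansion of a numerical step, with exact
    integrals in place of [Aform]. *)
Lemma exact_component N i : bigO01 N.+1 (fun h _ => y h i 0 - y0 i 0 -
  \sum_k \sum_(a < N) \sum_(b < N | (a + b < N)%N)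
    h ^+ (a + b).+1 * (T (Sf i k) a * T (gf k) b / (a + b).+1%:R)).
Proof.
have [y00 dy] := yP.
pose du h := \sum_k (Sf i k (y h) * gf k (y h) -
  \sum_(a < N) \sum_(b < N | (a + b < N)%N) h ^+ (a + b) * (T (Sf i k) a * T (gf k) b)).
apply: (@bigO01_primitive _ _ _ du).
- apply: filterS dy => t dyt.
  have dyi : is_derive t (1 : R) (fun h => y h i 0) (\sum_k Sf i k (y t) * gf k (y t)).
    have := is_derive_comp_path (differentiable_coord (y t) i 0) dyt.
    rewrite -derive_gradient; last exact: differentiable_coord.
    by rewrite derive_coord /poisson_field mxE.
  rewrite /du sumrB; apply: is_deriveB.
    rewrite -[X in is_derive _ _ _ X]subr0; apply: is_deriveB.
  apply: is_derive_bigsum => k _; apply: is_derive_bigsum => a _.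
  by apply: is_derive_bigsum => b _; exact: is_derive_monomial.
- rewrite y00 subrr sub0r big1 ?oppr0// => k _; rewrite big1// => a _.
  by rewrite big1// => b _; rewrite expr0n/= mul0r.
- apply: bigO01_sum => k _.
  apply: (@expandsM _ N (fun h _ => Sf i k (y h)) (fun h _ => gf k (y h))
    (fun n _ => T (Sf i k) n) (fun n _ => T (gf k) n)).
  + by move=> n; exact: bigO01_cst.
  + by move=> n; exact: bigO01_cst.
  + apply: bigO01_eq (taylor_along SH yP N (sS i k)) => h _.
    by congr (_ - _); apply: eq_bigr => n _; rewrite mulrC.
  + apply: bigO01_eq (taylor_along SH yP N (sg k)) => h _.
    by congr (_ - _); apply: eq_bigr => n _; rewrite mulrC.
Qed.

Variables (M : 3.-tuple 'M[R]_3) (c : 3.-tuple R) (Y : R -> R -> 'cV[R]_d).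
Hypothesis c01 : forall j, 0 <= tnth c j <= 1.
Hypothesis cY : forall h, continuous (Y h).
Hypothesis YE : \forall h \near (0 : R), forall tau, 0 <= tau <= 1 -> forall i,
  Y h tau i 0 = y0 i 0 +
    h * \sum_k Aform M c tau (fun z => Sf i k (Y h z)) (fun z => gf k (Y h z)).
Hypothesis YO : bigO01 1 (fun h tau => `|Y h tau - y0|).

Let e i h tau := Y h tau i 0 - y (h * tau) i 0.

Lemma exact_bigO01 : bigO01 1 (fun h tau => `|y (h * tau) - y0|).
Proof.
apply: bigO01_cV => i; apply: (@bigO01_scale _ 1 (fun h => (y h - y0) i 0)).
apply: bigO01_eq (exact_component 0 i) => h _.
by rewrite big1 ?subr0 ?mxE// => k _; rewrite big_ord0.
Qed.

Lemma error_bigO01_norm N : (forall i, bigO01 N (e i)) ->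
  bigO01 N (fun h tau => `|Y h tau - y (h * tau)|).
Proof.
by move=> eO; apply: bigO01_cV => i; apply: bigO01_eq (eO i) => h tau; rewrite !mxE.
Qed.

Lemma error_bigO01_1 i : bigO01 1 (e i).
Proof.
apply: bigO01_le (bigO01D YO exact_bigO01); near=> h => tau _.
rewrite [leRHS]ger0_norm ?addr_ge0//.
have -> : e i h tau = ((Y h tau - y0) - (y (h * tau) - y0)) i 0.
  by rewrite /e !mxE; ring.
by apply: le_trans (norm_coord_le _ _ _) _; exact: ler_normB.
Unshelve. all: by end_near. Qed.

Lemma smooth_error N phi : smooth phi -> (forall i, bigO01 N (e i)) ->
  bigO01 N (fun h tau => phi (Y h tau) - phi (y (h * tau))).
Proof.
move=> sphi /error_bigO01_norm eO.
have [L [r [L0 r0 LP]]] := smooth_lipschitz y0 sphi.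
have LeO := bigO01M (bigO01_cst L) eO; rewrite add0n in LeO.
have yr := bigO01_small exact_bigO01 r0; have Yr := bigO01_small YO r0.
apply: bigO01_le LeO; near=> h => tau tau01.
rewrite normrM normr_id [`|L|]ger0_norm//; apply: LP; rewrite -[ltLHS]normr_id.
  exact: (near yr h).
exact: (near Yr h).
Unshelve. all: by end_near. Qed.

Lemma exact_expands N phi : smooth phi ->
  expands N (fun h tau => phi (y (h * tau))) (fun n tau => T phi n * tau ^+ n).
Proof.
move=> sphi; have := bigO01_scale (taylor_along SH yP N sphi).
apply: bigO01_eq => h tau; congr (_ - _); apply: eq_bigr => n _.
by rewrite exprMn mulrCA.
Qed.

Lemma smooth_expands N phi : smooth phi -> (forall i, bigO01 N (e i)) ->
  expands N (fun h tau => phi (Y h tau)) (fun n tau => T phi n * tau ^+ n).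
Proof.
move=> sphi eO; have := bigO01D (smooth_error sphi eO) (exact_expands N sphi).
by apply: bigO01_eq => h tau; rewrite addrA subrK.
Qed.

(** The factor [h] in the stage equation turns expansions to order [N] into an error known to order
    [N + 1]. The coefficients [s] and [g] are left arbitrary: they are first the Taylor coefficients
    of the exact solution, and at the end perturbed ones. *)
Lemma error_expands N (s : 'I_d -> 'I_d -> nat -> R -> R) (g : 'I_d -> nat -> R -> R) i :
  (forall k n, continuous (g k n)) ->
  (forall k, expands N (fun h tau => Sf i k (Y h tau)) (s i k)) ->
  (forall k, expands N (fun h tau => gf k (Y h tau)) (g k)) ->
  bigO01 N.+1 (fun h tau => e i h tau -
    \sum_k \sum_(a < N) \sum_(b < N | (a + b < N)%N) h ^+ (a + b).+1 *
      (Aform M c tau (s i k a) (g k b) -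
       T (Sf i k) a * T (gf k) b * (tau ^+ (a + b).+1 / (a + b).+1%:R))).
Proof.
move=> cg sE gE.
have cgY k h : continuous (fun z => gf k (Y h z)).
  by move=> z; apply: continuous_comp; [exact: cY|exact: (smooth_continuous (sg k))].
have YO' := @bigO01_hM _ 1 N _ (bigO01_sum (index_enum 'I_d) (P := predT)
  (fun k _ => Aform_expand M c01 (cgY k) (cg k) (sE k) (gE k))).
have yO' := bigO01_scale (exact_component N i).
apply: bigO01_near_eq (bigO01B YO' yO'); near=> h => tau tau01.
rewrite /e (near YE h)//.
rewrite sumrB mulrBr !mulr_sumr.
under [X in _ = _ - X]eq_bigr do under eq_bigr do under eq_bigr do rewrite mulrBr.
under [X in _ = _ - X]eq_bigr do under eq_bigr do rewrite sumrB.
under [X in _ = _ - X]eq_bigr do rewrite sumrB.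
rewrite [X in _ = _ - X]sumrB.
set A := \sum_k (_ * Aform _ _ _ _ _).
set B := \sum_k (_ * \sum_a _).
set B' := \sum_k \sum_a \sum_(b < N | _) (_ * Aform _ _ _ _ _).
set D := \sum_k \sum_a \sum_(b < N | _) _.
set D' := \sum_k \sum_a \sum_(b < N | _) _.
have -> : B = B'.
  apply: eq_bigr => k _; rewrite mulr_sumr; apply: eq_bigr => a _.
  by rewrite mulr_sumr; apply: eq_bigr => b _; rewrite expr1 mulrA exprS.
have -> : D = D'.
  apply: eq_bigr => k _; apply: eq_bigr => a _; apply: eq_bigr => b _.
  rewrite exprMn; ring.
ring.
Unshelve. all: by end_near. Qed.

Local Notation p := (Aform_defect M c).

(* The conditions on the coefficients enter the order only through these. *)
Hypothesis p_low : forall a b tau, (a + b < 2)%N -> p a b tau = 0.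
Hypothesis p_anti : forall a b tau, (a + b = 2)%N -> p a b (1 - tau) = - p a b tau.
Hypothesis p_at1 : forall a b, (a + b < 4)%N -> p a b 1 = 0.
Hypothesis Aform_antil : forall W : R -> R, continuous W ->
  (forall tau, W (1 - tau) = - W tau) -> Aform M c 1 W (fun z => z ^+ 0) = 0.
Hypothesis Aform_antir : forall W : R -> R, continuous W ->
  (forall tau, W (1 - tau) = - W tau) -> Aform M c 1 (fun z => z ^+ 0) W = 0.

Let cX (k : R) n : continuous (fun z : R => k * z ^+ n).
Proof. by move=> z; apply: cvgM; [exact: cvg_cst|exact: exprn_continuous]. Qed.

(** As long as the stage error is O(h^N), the numerical and exact curves share their Taylor
    coefficients below order [N], so the coefficients of the error are products of these with the
    defects [p]. *)
Lemma error_leading N : (forall i, bigO01 N (e i)) -> forall i,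
  bigO01 N.+1 (fun h tau => e i h tau -
    \sum_k \sum_(a < N) \sum_(b < N | (a + b < N)%N)
      h ^+ (a + b).+1 * (T (Sf i k) a * T (gf k) b * p a b tau)).
Proof.
move=> eO i; have := @error_expands N (fun i k n tau => T (Sf i k) n * tau ^+ n)
  (fun k n tau => T (gf k) n * tau ^+ n) i (fun k n => @cX (T (gf k) n) n)
  (fun k => smooth_expands (sS i k) eO) (fun k => smooth_expands (sg k) eO).
apply: bigO01_eq => h tau; congr (_ - _).
apply: eq_bigr => k _; apply: eq_bigr => a _; apply: eq_bigr => b _.
by rewrite AformZ; [rewrite -!mulrBr|exact: exprn_continuous].
Qed.

(** For [N <= 2] all defects in the leading part have [a + b < 2] and vanish. *)
Lemma error_bootstrap N : (N <= 2)%N -> (forall i, bigO01 N (e i)) ->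
  forall i, bigO01 N.+1 (e i).
Proof.
move=> N2 eO i; apply: bigO01_eq (error_leading eO i) => h tau.
rewrite big1 ?subr0// => k _; rewrite big1// => a _; rewrite big1// => b abN.
by rewrite p_low ?mulr0//; exact: leq_trans N2.
Qed.

Lemma error_bigO01_3 i : bigO01 3 (e i).
Proof. by do 2 apply: error_bootstrap => // {}i; exact: error_bigO01_1. Qed.

(** The coefficient of [h^3] in the stage error: by [p_low], only the terms with [a + b = 2]
    contribute. *)
Let E i tau := \sum_k \sum_(a < 3) \sum_(b < 3 | (a + b < 3)%N)
  T (Sf i k) a * T (gf k) b * p a b tau.

Lemma error_cubic i : bigO01 4 (fun h tau => e i h tau - h ^+ 3 * E i tau).
Proof.
apply: bigO01_eq (error_leading error_bigO01_3 i) => h tau; congr (_ - _).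
rewrite /E mulr_sumr; apply: eq_bigr => k _; rewrite mulr_sumr; apply: eq_bigr => a _.
rewrite mulr_sumr; apply: eq_bigr => b; rewrite ltnS leq_eqVlt => /orP[/eqP->//|ab2].
by rewrite p_low// !mulr0.
Qed.

Let E_anti i tau : E i (1 - tau) = - E i tau.
Proof.
rewrite /E -sumrN; apply: eq_bigr => k _; rewrite -sumrN; apply: eq_bigr => a _.
rewrite -sumrN; apply: eq_bigr => b; rewrite ltnS leq_eqVlt => /orP[/eqP ab|ab2].
  by rewrite p_anti// mulrN.
by rewrite !p_low// !mulr0 oppr0.
Qed.

Let continuous_E i : continuous (E i).
Proof.
apply: continuous_sum => k; apply: continuous_sum => a.
under eq_fun do rewrite -big_filter; apply: continuous_sum => b x.
apply: cvgM; first exact: cvg_cst.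
apply: cvgB; first exact: Aform_continuous.
by apply: cvgM; [exact: exprn_continuous|exact: cvg_cst].
Qed.

(** The cubic perturbation that the stage error causes in [phi]: the derivative of [phi] at [y0] in
    the direction [E]. *)
Let W phi tau := \sum_i E i tau * gradient phi y0 i 0.

Let continuous_W phi : continuous (W phi).
Proof.
by apply: continuous_sum => i x; apply: cvgM; [exact: continuous_E|exact: cvg_cst].
Qed.

Let W_anti phi tau : W phi (1 - tau) = - W phi tau.
Proof. by rewrite /W -sumrN; apply: eq_bigr => i _; rewrite E_anti mulNr. Qed.

(* The numerical solution shares the Taylor coefficients of the exact one, up
   to an odd perturbation of the cubic term. *)
Let coef phi n tau := T phi n * tau ^+ n + (if n == 3 then W phi tau else 0).

Let continuous_coef phi n : continuous (coef phi n).
Proof.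
move=> x; apply: cvgD; first exact: cX.
by case: ifP => _; [exact: continuous_W|exact: cvg_cst].
Qed.

Let coordB (v w : 'cV[R]_d) i : (v - w) i 0 = v i 0 - w i 0.
Proof. by rewrite !mxE. Qed.

(** The difference of [phi] on the two curves is linearized at [y0]. The nonlinear rest is O(h)
    times O(h^3) by [taylor2], and the linear part is [h^3 W] up to O(h^4). *)
Lemma smooth_expands4 phi : smooth phi ->
  expands 4 (fun h tau => phi (Y h tau)) (coef phi).
Proof.
move=> sphi.
have [L [r [L0 r0 LP]]] := taylor2 y0 sphi.
have yr := bigO01_small exact_bigO01 r0; have Yr := bigO01_small YO r0.
have quadO : bigO01 4 (fun h tau => phi (Y h tau) - phi (y (h * tau)) -
    \sum_i e i h tau * gradient phi y0 i 0).
  have B := bigO01M (bigO01M (bigO01_cst L) (bigO01D exact_bigO01 YO))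
                    (error_bigO01_norm error_bigO01_3).
  apply: bigO01_le B; near=> h => tau tau01.
  rewrite [leRHS]ger0_norm; last by rewrite !mulr_ge0 ?addr_ge0.
  have := LP (y (h * tau)) (Y h tau).
  under [\sum_i _]eq_bigr do rewrite coordB.
  apply; rewrite -[ltLHS]normr_id; first exact: (near yr h).
  exact: (near Yr h).
have linO : bigO01 4 (fun h tau => \sum_i e i h tau * gradient phi y0 i 0 - h ^+ 3 * W phi tau).
  have B i : bigO01 4 (fun h tau => (e i h tau - h ^+ 3 * E i tau) * gradient phi y0 i 0).
    exact: (bigO01M (error_cubic i) (bigO01_cst _)).
  apply: bigO01_eq (bigO01_sum (index_enum 'I_d) (P := predT) (fun i _ => B i)) => h tau.
  by rewrite /W mulr_sumr -sumrB; apply: eq_bigr => i _; rewrite mulrBl mulrA.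
apply: bigO01_eq (bigO01D (bigO01D quadO linO) (exact_expands 4 sphi)) => h tau.
rewrite !big_ord_recr !big_ord0/= /coef/=; ring.
Unshelve. all: by end_near. Qed.

(** Every coefficient with [a + b < 4] vanishes at [tau = 1]. Its unperturbed part vanishes by
    [p_at1]; a perturbation occurs only at index 3, so its partner has index 0 and is constant, and
    oddness of [W] removes the product. *)
Lemma local_error i : bigO01 5 (fun h _ => Y h 1 i 0 - y h i 0).
Proof.
have := @error_expands 4 (fun i k => coef (Sf i k)) (fun k => coef (gf k)) i
  (fun k => @continuous_coef (gf k)) (fun k => smooth_expands4 (sS i k))
  (fun k => smooth_expands4 (sg k)).
move=> /(bigO01_at (c := 1)); rewrite lexx ler01 => /(_ isT).
apply: bigO01_eq => h _; rewrite /e mulr1 [X in _ - X]big1 ?subr0// => k _.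
rewrite big1// => a _; rewrite big1// => b ab4.
apply/eqP; rewrite mulf_eq0; apply/orP; right; apply/eqP.
have cXn n : continuous (fun z : R => z ^+ n) by exact: exprn_continuous.
have pab : Aform M c 1 (fun z => T (Sf i k) a * z ^+ a) (fun z => T (gf k) b * z ^+ b)
    = T (Sf i k) a * T (gf k) b * (1 ^+ (a + b).+1 / (a + b).+1%:R).
  by rewrite AformZ//; congr (_ * _); apply/subr0_eq; exact: (p_at1 ab4).
have coefE phi n : (n == 3) = false -> coef phi n = fun z => T phi n * z ^+ n.
  by move=> n3; apply/funext => z; rewrite /coef n3 addr0.
(* The factor 1 gives the perturbation the form of a scalar multiple, as [AformZ] expects. *)
have coef3 phi n : (n == 3) = true -> coef phi n = fun z => T phi n * z ^+ n + 1 * W phi z.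
  by move=> n3; apply/funext => z; rewrite /coef n3 mul1r.
have [a3|a3] := boolP (a == 3 :> nat).
  have b0 : b = 0 :> nat by move: ab4; rewrite (eqP a3); case: (nat_of_ord b).
  rewrite (coef3 _ _ a3) coefE ?b0// AformDl -b0 pab AformZ//.
  by rewrite b0 Aform_antil// mulr0 addr0 subrr.
have [b3|b3] := boolP (b == 3 :> nat).
  have a0 : a = 0 :> nat by move: ab4; rewrite (eqP b3) addnC; case: (nat_of_ord a).
  rewrite (coef3 _ _ b3) coefE ?a0// AformDr//; last first.
    by move=> x; apply: cvgM; [exact: cvg_cst|exact: continuous_W].
  by rewrite -a0 pab AformZ// a0 Aform_antir// mulr0 addr0 subrr.
by rewrite !coefE ?(negbTE a3) ?(negbTE b3)// pab subrr.
Qed.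

End LocalError.

(** * Consequences of the conditions on the coefficients *)

Section Tableau.
Variable R : realType.
Implicit Types (s g : R -> R) (tau : R).

Let o0 := @Ordinal 3 0 isT.
Let o1 := @Ordinal 3 1 isT.
Let o2 := @Ordinal 3 2 isT.

Lemma ord3P (P : 'I_3 -> Prop) : P o0 -> P o1 -> P o2 -> forall i, P i.
Proof.
move=> P0 P1 P2 [[|[|[|//]]] i3].
- by rewrite (_ : Ordinal i3 = o0)//; exact/val_inj.
- by rewrite (_ : Ordinal i3 = o1)//; exact/val_inj.
- by rewrite (_ : Ordinal i3 = o2)//; exact/val_inj.
Qed.

Lemma sum3 (V : nmodType) (F : 'I_3 -> V) : \sum_i F i = F o0 + F o1 + F o2.
Proof.
rewrite !big_ord_recl big_ord0 addr0 addrA.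
by congr (F _ + F _ + F _); exact/val_inj.
Qed.

Definition weights tau : 'rV[R]_3 := \row_p (tau ^+ p.+1 / p.+1%:R).
Definition moments g : 'cV[R]_3 := \col_q int01 (fun z => z ^+ q * g z).

(** In matrix form, the algebraic conditions on the coefficients act by multiplication on either
    side. *)
Lemma AformE (M : 3.-tuple 'M[R]_3) (c : 3.-tuple R) tau s g :
  Aform M c tau s g =
  (weights tau *m (\sum_j s (tnth c j) *: tnth M j) *m moments g) 0 0.
Proof.
rewrite mulmx_sumr mulmx_suml summxE; apply: eq_bigr => j _.
rewrite -scalemxAr -scalemxAl mxE [X in s _ * X]mxE mulr_sumr exchange_big/=.
apply: eq_bigr => q _; rewrite [in RHS]mxE mulr_suml mulr_sumr.
by apply: eq_bigr => p _; rewrite !mxE; ring.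
Qed.

(* Right multiplication by [onem_mx] maps [(1, z, z^2)] to its value at [1 - z]. *)
Definition onem_mx : 'M[R]_3 :=
  mx_of_seq 3 3 [:: [:: 1; 1; 1]; [:: 0; -1; -2]; [:: 0; 0; 1]].

(** The substitution of [1 - z] for [z] is an involution. *)
Lemma mulmx_onem_mx : onem_mx *m onem_mx = 1%:M.
Proof.
by apply/matrixP; apply: ord3P; apply: ord3P;
  rewrite !mxE !sum3 !mxE/=; ring.
Qed.

(** The weights are the integrals of [1, z, z^2] over [[0, tau]]; the left side integrates over
    [[1 - tau, 1]], which reflection maps onto [[0, tau]]. *)
Lemma weights_onem tau : weights 1 - weights (1 - tau) = weights tau *m onem_mx.
Proof.
by apply/rowP; apply: ord3P; rewrite !mxE !sum3 !mxE/=; field.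
Qed.

(** Substituting [1 - z] under the integral moves the reflection from [g] to the monomials. *)
Lemma moments_onem g : continuous g ->
  moments (fun z => g (1 - z)) = onem_mx^T *m moments g.
Proof.
move=> cg; have cgX n : continuous (fun z : R => z ^+ n * g z).
  by move=> z; apply: cvgM; [exact: exprn_continuous|exact: cg].
have cZ (k : R) (f : R -> R) : continuous f -> continuous (fun z => k * f z).
  by move=> cf z; apply: cvgM; [exact: cvg_cst|exact: cf].
apply/colP => q; rewrite !mxE.
transitivity (int01 (fun z => \sum_(q' < 3) onem_mx q' q * (z ^+ q' * g z))).
  rewrite -(@int01_onem _ (fun z => \sum_(q' < 3) onem_mx q' q * (z ^+ q' * g z))).
    apply: eq_int01 => z _; under eq_bigr do rewrite mulrA; rewrite -mulr_suml.
    congr (_ * _); elim/ord3P: q; rewrite !sum3 !mxE/=; ring.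
  by apply: continuous_sum => q'; exact: cZ.
rewrite int01_sum; last by move=> q'; exact: cZ.
by apply: eq_bigr => q' _; rewrite int01Z// !mxE.
Qed.

Variables (M1 M2 M3 : 'M[R]_3) (c1 c2 c3 alpha : R).
Let M := [tuple M1; M2; M3].
Let c := [tuple c1; c2; c3].

(** The Gram matrix of [1, z, z^2] on the unit interval, except that the corner [alpha] need not be
    1/5. *)
Let gram : 'M[R]_3 := mx_of_seq 3 3 [:: [:: 1; 2^-1; 3^-1]; [:: 2^-1; 3^-1; 4^-1];
                                        [:: 3^-1; 4^-1; alpha]].

Hypothesis symM : [/\ M1 = M1^T, M2 = M2^T & M3 = M3^T].
Hypothesis gramM : gram *m (M1 + M2 + M3) = 1%:M.
Hypothesis onemM : onem_mx *m M3 *m onem_mx^T = M1.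
Hypothesis c13 : c1 + c3 = 1.
Hypothesis c2E : c2 = 2^-1.
Let u : 'cV[R]_3 := mx_of_seq 3 1 [:: [:: 1]; [:: 2^-1]; [:: 3^-1]].
Hypothesis momentS : (c1 *: M1 + c2 *: M2 + c3 *: M3) *m u
  = mx_of_seq 3 1 [:: [:: 0]; [:: 1]; [:: 0]].
Hypothesis momentSS : (mx_of_seq 1 3 [:: [:: 1; 2^-1; 3^-1]]
  *m (c1 ^+ 2 *: M1 + c2 ^+ 2 *: M2 + c3 ^+ 2 *: M3) *m u) 0 0 = 3^-1.

Let Mgram : (M1 + M2 + M3) *m gram = 1%:M.
Proof. exact: mulmx1C. Qed.

(** For the true Gram matrix this is invariance of the integral under reflection. Changing the
    corner preserves it, because the last row of [onem_mx] is the last unit vector. *)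
Let gram_onem : onem_mx^T *m gram *m onem_mx = gram.
Proof.
apply/matrixP; apply: ord3P; apply: ord3P;
  rewrite !mxE !sum3 !mxE !sum3 !mxE/=; by field.
Qed.

Let trmx_onem : onem_mx^T *m onem_mx^T = 1%:M :> 'M[R]_3.
Proof. by rewrite -trmx_mul mulmx_onem_mx trmx1. Qed.

(** The sum is the inverse of [gram], so it inherits the invariance of [gram]. *)
Let onem_sum : onem_mx *m (M1 + M2 + M3) *m onem_mx^T = M1 + M2 + M3.
Proof.
set Q := onem_mx; set N := _ + M3.
have QN : gram *m (Q *m N *m Q^T) = 1%:M.
  rewrite -gram_onem !mulmxA -(mulmxA (Q^T *m gram)) mulmx_onem_mx mulmx1.
  by rewrite -[_ *m gram *m N]mulmxA gramM mulmx1 trmx_onem.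
by rewrite -[LHS]mul1mx -Mgram -mulmxA QN mulmx1.
Qed.

Let onemM1 : onem_mx *m M1 *m onem_mx^T = M3.
Proof.
rewrite -onemM !mulmxA mulmx_onem_mx mul1mx -mulmxA trmx_onem mulmx1 //.
Qed.

(** Reflection exchanges [M1] and [M3]; cancelling them in the invariance of the sum leaves [M2]. *)
Let onemM2 : onem_mx *m M2 *m onem_mx^T = M2.
Proof.
have := onem_sum; rewrite !mulmxDr !mulmxDl onemM1 onemM.
by rewrite addrAC [RHS]addrAC [M3 + M1]addrC => /addrI.
Qed.

Lemma sum_tableau (s : R -> R) :
  \sum_j s (tnth c j) *: tnth M j = s c1 *: M1 + s c2 *: M2 + s c3 *: M3.
Proof. by rewrite sum3 !(tnth_nth 0). Qed.

(** Reflection swaps the outer nodes and fixes the middle one, while [onem_mx] does the same to the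
    matrices; hence it can be carried from the moments through the matrices to the weights. *)
Lemma Aform_onem tau s g : continuous g ->
  Aform M c tau (fun z => s (1 - z)) (fun z => g (1 - z)) =
  Aform M c 1 s g - Aform M c (1 - tau) s g.
Proof.
move=> cg; rewrite !AformE (moments_onem cg).
rewrite (sum_tableau (fun z => s (1 - z))) (sum_tableau s).
have -> : 1 - c1 = c3 by rewrite -c13 addrC addKr.
have -> : 1 - c3 = c1 by rewrite -c13 addrK.
have -> : 1 - c2 = c2 by rewrite c2E; field.
transitivity (((weights 1 - weights (1 - tau)) *m
    (s c1 *: M1 + s c2 *: M2 + s c3 *: M3) *m moments g) 0 0); last first.
  by rewrite !mulmxBl !mxE.
rewrite weights_onem; congr (fun_of_matrix _ 0 0); rewrite !mulmxA; congr (_ *m _).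
rewrite -!mulmxA; congr (_ *m _).
rewrite !mulmxDr !mulmxDl -!scalemxAl -!scalemxAr.
have -> : M1 *m onem_mx^T = onem_mx *m M3.
  by rewrite -onemM -mulmxA trmx_onem mulmx1.
have -> : M3 *m onem_mx^T = onem_mx *m M1.
  by rewrite -onemM1 -mulmxA trmx_onem mulmx1.
have -> : M2 *m onem_mx^T = onem_mx *m M2.
  by rewrite -{1}onemM2 -mulmxA trmx_onem mulmx1.
by rewrite addrC addrA addrAC.
Qed.

Let cexp n : continuous (fun z : R => z ^+ n). Proof. exact: exprn_continuous. Qed.

Lemma moments_exp b (q : 'I_3) : moments (fun z => z ^+ b) q 0 = (q + b).+1%:R^-1.
Proof.
rewrite mxE -int01X; apply: eq_int01 => z _; exact: esym (exprD _ _ _).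
Qed.

Let Aform_linr tau s (k : R) (f g : R -> R) : continuous f -> continuous g ->
  Aform M c tau s (fun z => f z + k * g z) = Aform M c tau s f + k * Aform M c tau s g.
Proof.
move=> cf cg; rewrite AformDr//; last first.
  by move=> x; apply: cvgM; [exact: cvg_cst|exact: cg].
congr (_ + _); rewrite -[k in RHS]mul1r -AformZ//; congr Aform.
by apply/funext => z; rewrite mul1r.
Qed.

Let Aform_linl tau s (k : R) t g : continuous g ->
  Aform M c tau (fun z => s z + k * t z) g = Aform M c tau s g + k * Aform M c tau t g.
Proof.
move=> cg; rewrite AformDl; congr (_ + _).
rewrite -[k in RHS]mulr1 -AformZ//; congr Aform.
by apply/funext => z; rewrite mul1r.
Qed.

Lemma Aform_const tau b : (b < 2)%N ->
  Aform M c tau (fun z => z ^+ 0) (fun z => z ^+ b) = tau ^+ b.+1 / b.+1%:R.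
Proof.
move=> b2; rewrite AformE (sum_tableau (fun z => z ^+ 0)) !scale1r.
pose b' : 'I_3 := inord b.
have bE : b' = b :> nat by rewrite inordK// ltnW.
(* The moments of [z^b] form a column of [gram]. This uses [b < 2], since the third column contains
   [alpha]. *)
have -> : moments (fun z => z ^+ b) = gram *m delta_mx b' 0.
  rewrite -colE; apply/colP => q; rewrite moments_exp mxE.
  rewrite -bE; move: b' {bE}(leq_ltn_trans (eq_leq bE) b2); apply: ord3P => //= _;
    by elim/ord3P: q; rewrite mxE/= ?invr1.
by rewrite -mulmxA (mulmxA _ gram) Mgram mul1mx -colE !mxE bE.
Qed.

Lemma Aform_linear tau :
  Aform M c tau (fun z => z ^+ 1) (fun z => z ^+ 0) = tau ^+ 2 / 2.
Proof.
rewrite AformE (sum_tableau (fun z => z ^+ 1)) !expr1.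
have -> : moments (fun z => z ^+ 0) = u.
  by apply/colP => q; rewrite moments_exp addn0; elim/ord3P: q; rewrite mxE/= ?invr1.
by rewrite -mulmxA momentS !mxE sum3 !mxE/= !mulr0 mulr1 add0r addr0.
Qed.

Let weights1 : weights 1 = u^T.
Proof. by apply/rowP; apply: ord3P; rewrite !mxE/= ?expr1n ?mul1r ?invr1. Qed.

(** At [tau = 1] the weights are the first row of [gram], which cancels the sum of the matrices from
    the left whatever the moments are. *)
Lemma Aform_const1 b : Aform M c 1 (fun z => z ^+ 0) (fun z => z ^+ b) = b.+1%:R^-1.
Proof.
rewrite AformE (sum_tableau (fun z => z ^+ 0)) !scale1r.
have -> : weights 1 = delta_mx 0 o0 *m gram.
  by rewrite weights1 -rowE; apply/rowP; apply: ord3P; rewrite !mxE.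
by rewrite -[_ *m gram *m _]mulmxA gramM mulmx1 -rowE mxE moments_exp.
Qed.

(** By symmetry of the matrices, the fifth condition can be transposed to act on the weights at 1;
    it selects the moment with [q = 1]. *)
Lemma Aform_linear1 b : Aform M c 1 (fun z => z ^+ 1) (fun z => z ^+ b) = b.+2%:R^-1.
Proof.
rewrite AformE (sum_tableau (fun z => z ^+ 1)) !expr1 weights1.
have [s1 s2 s3] := symM.
set X := _ + c3 *: M3.
have XT : X^T = X by rewrite /X !linearD/= !linearZ/= -s1 -s2 -s3.
rewrite -XT -trmx_mul momentS mxE sum3 !moments_exp !mxE/=.
by rewrite !mul0r mul1r add0r addr0.
Qed.

Lemma Aform_quadratic1 : Aform M c 1 (fun z => z ^+ 2) (fun z => z ^+ 0) = 3^-1.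
Proof.
rewrite AformE (sum_tableau (fun z => z ^+ 2)) -momentSS; congr (fun_of_matrix (_ *m _ *m _) 0 0).
  by rewrite weights1; apply/rowP; apply: ord3P; rewrite !mxE.
by apply/colP => q; rewrite moments_exp addn0; elim/ord3P: q; rewrite mxE/= ?invr1.
Qed.

Let Aform_tau0 s g : Aform M c 0 s g = 0.
Proof.
rewrite AformE (_ : weights 0 = 0) ?mul0mx ?mxE//.
by apply/rowP => p; rewrite !mxE expr0n/= mul0r.
Qed.

Let Aform_onem1 s g : continuous g ->
  Aform M c 1 (fun z => s (1 - z)) (fun z => g (1 - z)) = Aform M c 1 s g.
Proof. by move=> cg; rewrite Aform_onem// subrr Aform_tau0 subr0. Qed.

Let onem0 : (fun z : R => z ^+ 0) = (fun z => (1 - z) ^+ 0).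
Proof. by []. Qed.

Let onem1 : (fun z : R => (1 - z) ^+ 1) = (fun z => z ^+ 0 + -1 * z ^+ 1).
Proof. by apply/funext => z; ring. Qed.

Let onem2 : (fun z : R => (1 - z) ^+ 2) = (fun z => z ^+ 0 + -2 * z ^+ 1 + 1 * z ^+ 2).
Proof. by apply/funext => z; ring. Qed.

Let onem3 : (fun z : R => (1 - z) ^+ 3) =
  (fun z => z ^+ 0 + -3 * z ^+ 1 + 3 * z ^+ 2 + -1 * z ^+ 3).
Proof. by apply/funext => z; ring. Qed.

Let conem1 (k : R) : continuous (fun z : R => z ^+ 0 + k * z ^+ 1).
Proof.
by move=> z; apply: cvgD; [exact: cexp|apply: cvgM; [exact: cvg_cst|exact: cexp]].
Qed.

(** Reflection invariance at [tau = 1] reverses the sign of the cubic term, so the unknown value [x]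
    satisfies [x = 1 - 3/2 + 1 - x]. *)
Lemma Aform_cubic1 : Aform M c 1 (fun z => z ^+ 3) (fun z => z ^+ 0) = 4^-1.
Proof.
have := @Aform_onem1 (fun z => z ^+ 3) (fun z => z ^+ 0) (@cexp 0).
rewrite -onem0 onem3 !Aform_linl// Aform_const1 Aform_linear1 Aform_quadratic1; lra.
Qed.

(** The total degree is again odd: expanding the reflected product gives [x = 1/2 - x] for the
    unknown value [x]. *)
Lemma Aform_quadratic_linear1 : Aform M c 1 (fun z => z ^+ 2) (fun z => z ^+ 1) = 4^-1.
Proof.
have := @Aform_onem1 (fun z => z ^+ 2) (fun z => z ^+ 1) (@cexp 1).
rewrite onem2 onem1 !(Aform_linl _ _ _ _ (@conem1 _)) !(Aform_linr _ _ _ (@cexp 0) (@cexp 1)).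
rewrite !Aform_const1 !Aform_linear1 Aform_quadratic1; lra.
Qed.

Local Notation p := (Aform_defect M c).

Lemma Aform_exact_low a b tau : (a + b < 2)%N -> p a b tau = 0.
Proof.
rewrite /Aform_defect; case: a b => [|[|a]] [|[|b]] //= _.
- by rewrite Aform_const// subrr.
- by rewrite Aform_const// subrr.
- by rewrite Aform_linear subrr.
Qed.

Lemma Aform_exact1 a b : (a + b < 4)%N -> p a b 1 = 0.
Proof.
rewrite /Aform_defect expr1n mul1r; case: a b => [b _|[b _|[|[|a]]]].
- by rewrite Aform_const1 add0n subrr.
- by rewrite Aform_linear1 add1n subrr.
- by case=> [|[|//]] _; rewrite ?Aform_quadratic1 ?Aform_quadratic_linear1 subrr.
- by case=> [|//] _; rewrite Aform_cubic1 subrr.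
- by [].
Qed.

(** Expand the reflected monomials in [Aform_onem]: the top term keeps its sign because the total
    degree is even, and the lower terms are exact. This fixes the sum of the values at [tau] and
    [1 - tau]. *)
Lemma Aform_defect_onem a b tau : (a + b = 2)%N -> p a b (1 - tau) = - p a b tau.
Proof.
rewrite /Aform_defect; move=> ab2; rewrite ab2.
have H : Aform M c 1 (fun z => z ^+ a) (fun z => z ^+ b) = 3^-1.
  have := @Aform_exact1 a b; rewrite ab2 => /(_ isT)/eqP.
  by rewrite /Aform_defect ab2 expr1n mul1r subr_eq0 => /eqP.
have := @Aform_onem tau (fun z => z ^+ a) (fun z => z ^+ b) (@cexp b).
rewrite H; move: ab2; case: a b {H} => [|[|[|//]]] [|[|[|//]]] //= _.
- rewrite -onem0 onem2 (Aform_linr _ _ _ (@conem1 _) (@cexp 2)).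
  rewrite !(Aform_linr _ _ _ (@cexp 0) (@cexp 1)) !(@Aform_const _ 0 isT) ?(@Aform_const _ 1 isT); lra.
- rewrite onem1 !(Aform_linl _ _ _ _ (@conem1 _)) !(Aform_linr _ _ _ (@cexp 0) (@cexp 1)).
  rewrite !(@Aform_const _ 0 isT) ?(@Aform_const _ 1 isT) Aform_linear; lra.
- by rewrite -onem0 onem2 !Aform_linl// !(@Aform_const _ 0 isT) ?(@Aform_const _ 1 isT) Aform_linear; lra.
Qed.

Let onem_antisym (W : R -> R) : (forall tau, W (1 - tau) = - W tau) ->
  (fun z : R => W (1 - z) + 2 * W z) = W.
Proof. by move=> W1; apply/funext => z; rewrite W1; ring. Qed.

(** Reflection leaves the value [x] unchanged, and writing [W] as its reflection plus twice itself
    gives [x = x + 2 x]. *)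
Lemma Aform_antisym_l (W : R -> R) : (forall tau, W (1 - tau) = - W tau) ->
  Aform M c 1 W (fun z : R => z ^+ 0) = 0.
Proof.
move=> W1; have := @Aform_onem1 W (fun z : R => z ^+ 0) (@cexp 0).
have := Aform_linl 1 (fun z : R => W (1 - z)) 2 W (@cexp 0).
rewrite (onem_antisym W1) -onem0; lra.
Qed.

Lemma Aform_antisym_r (W : R -> R) : continuous W ->
  (forall tau, W (1 - tau) = - W tau) -> Aform M c 1 (fun z : R => z ^+ 0) W = 0.
Proof.
move=> cW W1; have := @Aform_onem1 (fun z : R => z ^+ 0) W cW.
have cW' : continuous (fun z : R => W (1 - z)).
  by under eq_fun do rewrite W1; move=> z; apply: cvgN; exact: cW.
have := Aform_linr 1 (fun z : R => z ^+ 0) 2 cW' cW.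
rewrite (onem_antisym W1) -onem0; lra.
Qed.

End Tableau.

(** * The one-step map *)

Lemma coefA_sum (R : realType) (M : 3.-tuple 'M[R]_3) (j : 'I_3) (tau zeta : R) :
  coefA M j tau zeta =
  \sum_(p < 3) \sum_(q < 3) tau ^+ p.+1 / p.+1%:R * tnth M j p q * zeta ^+ q.
Proof.
rewrite /coefA mxE exchange_big/=; apply: eq_bigr => q _.
rewrite mxE mulr_suml; apply: eq_bigr => p _; rewrite !mxE.
congr (_ * _ * _); first by elim/ord3P: p => /=; rewrite ?divr1.
by elim/ord3P: q.
Qed.

Lemma continuous_polyvec (R : realType) d (Y : 'cV[{poly R}]_d) :
  continuous (polyvec_eval Y).
Proof.
move=> t; apply: differentiable_continuous; apply/derivable1_diffP.
apply/derivable_mxP => i j.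
rewrite (_ : (fun x => _) = horner (Y i 0)); first exact: derivable_horner.
by apply/funext => x; rewrite mxE.
Qed.

Section Stage.
Variables (R : realType) (d : nat) (S : 'cV[R]_d -> 'M[R]_d) (H : 'cV[R]_d -> R).
Hypothesis SH : poisson_system S H.
Variables (M : 3.-tuple 'M[R]_3) (c : 3.-tuple R).
Implicit Types (P : R -> 'cV[R]_d) (y : 'cV[R]_d).

Let sS i k : smooth (fun z => S z i k).
Proof. by case: SH => sS _ _; exact: smooth_coord. Qed.

Let sg k : smooth (fun z => gradient H z k 0).
Proof. by case: SH => _ sH _; exact: smooth_gradient. Qed.

Lemma continuous_gradient_path P k : continuous P ->
  continuous (fun z : R => gradient H (P z) k 0).
Proof.
move=> cP z; apply: (@continuous_comp _ _ _ P (fun z => gradient H z k 0)).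
  exact: cP.
exact: (smooth_continuous (sg k)).
Qed.

(** The path [P] and the point [y] are unrelated here, so the formula serves both to use a stage
    equation and to verify one. *)
Lemma stage_rhs (h tau : R) y P i : continuous P ->
  (y + h *: \sum_(j < 3) vintegral01 (fun zeta =>
      coefA M j tau zeta *: (S (P (tnth c j)) *m gradient H (P zeta)))) i 0 =
  y i 0 + h * \sum_k Aform M c tau (fun z => S (P z) i k)
                                   (fun z => gradient H (P z) k 0).
Proof.
move=> cP; rewrite mxE [X in _ + X]mxE summxE; congr (_ + _ * _).
rewrite exchange_big/=; apply: eq_bigr => j _; rewrite mxE.
have cm (q : 'I_3) k : continuous (fun z : R => z ^+ q * gradient H (P z) k 0).
  by apply: continuous_mulf; [exact: exprn_continuous|exact: continuous_gradient_path].
have cZ (l : R) (f : R -> R) : continuous f -> continuous (fun z => l * f z).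
  by move=> cf; apply: continuous_mulf => //; exact: cst_continuous.
transitivity (int01 (fun z => \sum_k \sum_(p < 3) \sum_(q < 3)
    (tau ^+ p.+1 / p.+1%:R * tnth M j p q * S (P (tnth c j)) i k) *
    (z ^+ q * gradient H (P z) k 0))).
  apply: eq_int01 => z _; rewrite mxE coefA_sum [X in _ * X]mxE mulr_sumr.
  apply: eq_bigr => k _; rewrite mulr_suml; apply: eq_bigr => p _.
  rewrite mulr_suml; apply: eq_bigr => q _; ring.
rewrite int01_sum => [|k]; last first.
  by do 2 apply: continuous_sum => ?; exact/cZ/cm.
apply: eq_bigr => k _; rewrite int01_sum => [|p]; last first.
  by apply: continuous_sum => ?; exact/cZ/cm.
apply: eq_bigr => p _; rewrite int01_sum => [|q]; last exact/cZ/cm.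
by apply: eq_bigr => q _; rewrite int01Z; [rewrite mulrA|exact: cm].
Qed.

Lemma stage_eq_coord (h : R) y (Y : 'cV[{poly R}]_d) (tau : R) i :
  stage_eq M c S H h y Y -> 0 <= tau <= 1 ->
  polyvec_eval Y tau i 0 = y i 0 + h * \sum_k Aform M c tau
    (fun z => S (polyvec_eval Y z) i k) (fun z => gradient H (polyvec_eval Y z) k 0).
Proof.
move=> [_ YE] tau01; rewrite -stage_rhs; last exact: continuous_polyvec.
by rewrite -YE.
Qed.

Lemma step_value_eval (h : R) y (Y : 'cV[{poly R}]_d) :
  stage_eq M c S H h y Y -> step_value M c S H h y Y = polyvec_eval Y 1.
Proof. by move=> [_ YE]; rewrite YE// ler01 lexx. Qed.

Lemma stage_eval0 (h : R) y (Y : 'cV[{poly R}]_d) :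
  stage_eq M c S H h y Y -> polyvec_eval Y 0 = y.
Proof.
move=> YE; apply/colP => i; rewrite (stage_eq_coord _ YE) ?lexx ?ler01//.
rewrite big1 ?mulr0 ?addr0// => k _; rewrite /Aform.
by rewrite big1// => j _; rewrite big1// => p _; rewrite big1// => q _;
  rewrite expr0n/= !mul0r.
Qed.

Hypothesis c01 : forall j, 0 <= tnth c j <= 1.

Lemma norm_Aform_le (tau : R) (s g : R -> R) (B : R) : 0 <= tau <= 1 -> 0 <= B ->
  continuous g ->
  (forall z, 0 <= z <= 1 -> `|s z| <= B) -> (forall z, 0 <= z <= 1 -> `|g z| <= B) ->
  `|Aform M c tau s g| <= (\sum_j \sum_p \sum_q `|tnth M j p q|) * B ^+ 2.
Proof.
move=> /andP[tau0 tau1] B0 cg sB gB; rewrite /Aform.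
apply: le_trans (ler_norm_sum _ _ _) _; rewrite mulr_suml; apply: ler_sum => j _.
apply: le_trans (ler_norm_sum _ _ _) _; rewrite mulr_suml; apply: ler_sum => p _.
apply: le_trans (ler_norm_sum _ _ _) _; rewrite mulr_suml; apply: ler_sum => q _.
rewrite normrM [X in X * _ <= _]normrM [X in _ * X <= _]normrM; apply: ler_pM; rewrite ?mulr_ge0//.
  rewrite ler_piMl// ger0_norm; last by rewrite divr_ge0// exprn_ge0.
  rewrite ler_pdivrMr ?ltr0n// mul1r; apply: (@le_trans _ _ 1).
    by rewrite exprn_ile1.
  by rewrite ler1n.
rewrite expr2; apply: ler_pM => //; first exact/sB/c01.
apply: norm_int01_le => [|z z01].
  by apply: continuous_mulf => //; exact: exprn_continuous.
have /andP[z0 z1] := z01; rewrite normrM -[leRHS]mul1r; apply: ler_pM => //; last exact: gB.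
by rewrite ger0_norm ?exprn_ge0// exprn_ile1.
Qed.

(** The closed ball of the maximum norm is a product of segments, compact as a set of row vectors;
    transposition is continuous and carries the bound to columns. *)
Lemma continuous_bounded_cball (y : 'cV[R]_d) (r : R) (f : 'cV[R]_d -> R) : continuous f ->
  exists2 B, 0 <= B & forall z, `|z - y| <= r -> `|f z| <= B.
Proof.
move=> cf; pose I i : set R := `[y i 0 - r, y i 0 + r]%classic.
pose A : set 'rV[R]_d := [set v : 'rV[R]_d | forall i, I i (v ord0 i)]%classic.
have cA : compact A.
  apply: (@rV_compact _ _ I) => i.
  exact: segment_compact.
have ct : continuous (@trmx R 1 d).
  move=> v A' [Q Qv QA]; exists (fun i j => Q j i) => [i j|w Qw].
    by have := Qv j i; rewrite mxE.
  by apply: QA => i j; rewrite mxE; exact: Qw.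
have cft : {within A, continuous (f \o @trmx R 1 d)}%classic.
  apply: continuous_subspaceT => v; apply: continuous_comp; [exact: ct|exact: cf].
have [B [_ BP]] := compact_bounded (continuous_compact cft cA).
exists (`|B| + 1); first by rewrite addr_ge0.
move=> z zy; apply: (BP (`|B| + 1)); first by rewrite (le_lt_trans (ler_norm B))// ltrDl.
exists z^T; last by rewrite /= trmxK.
move=> i; rewrite /I /= mxE in_itv/= -ler_distlC.
by apply: le_trans zy; rewrite distrC [X in X <= _](_ : _ = `|(z - y) i 0|) ?norm_coord_le// !mxE distrC.
Qed.

End Stage.

Lemma is_derive_mx (R : realType) m n (F : R -> 'M[R]_(m, n)) (D : 'M[R]_(m, n)) (t : R) :
  (forall i j, is_derive t (1 : R) (fun x => F x i j) (D i j)) ->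
  is_derive t (1 : R) F D.
Proof.
move=> dF; have F' : derivable F t 1.
  by apply/derivable_mxP => i j; have [] := dF i j.
apply: DeriveDef => //; rewrite derive_mx//.
by apply/matrixP => i j; rewrite mxE; have [] := dF i j.
Qed.

(** * Energy preservation and symmetry *)

Section Method.
Variables (R : realType) (d : nat) (S : 'cV[R]_d -> 'M[R]_d) (H : 'cV[R]_d -> R).
Hypothesis SH : poisson_system S H.
Variables (M : 3.-tuple 'M[R]_3) (c : 3.-tuple R).
Hypothesis c01 : forall j, 0 <= tnth c j <= 1.

Let sS i k : smooth (fun z => S z i k).
Proof. by case: SH => sS _ _; exact: smooth_coord. Qed.

Let sH : smooth H. Proof. by case: SH. Qed.

Let sg k : smooth (fun z => gradient H z k 0).
Proof. exact: smooth_gradient. Qed.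

(** The uniqueness radius confines all stage values to the ball of radius [r + 1] about [ybar].
    There [S] and the gradient are bounded, and the stage equation supplies the factor [h]. The
    constant is uniform in [y], as composing two steps requires. *)
Lemma near_stage_bound (ybar : 'cV[R]_d) (r : R) : exists2 C, 0 <= C &
  forall h y Y, `|y - ybar| <= 1 -> near_stage M c S H r h y Y ->
  forall tau, 0 <= tau <= 1 -> `|polyvec_eval Y tau - y| <= C * `|h|.
Proof.
have /choice[BS BSP] (ik : 'I_d * 'I_d) : exists B, 0 <= B /\
    forall z, `|z - ybar| <= r + 1 -> `|S z ik.1 ik.2| <= B.
  have [B B0 BP] := @continuous_bounded_cball _ _ ybar (r + 1) _ (smooth_continuous (sS ik.1 ik.2)).
  by exists B.
have /choice[Bg BgP] k : exists B, 0 <= B /\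
    forall z, `|z - ybar| <= r + 1 -> `|gradient H z k 0| <= B.
  have [B B0 BP] := @continuous_bounded_cball _ _ ybar (r + 1) _ (smooth_continuous (sg k)).
  by exists B.
pose B := \sum_ik BS ik + \sum_k Bg k.
have BS0 : 0 <= \sum_ik BS ik by apply: sumr_ge0 => ik _; case: (BSP ik).
have Bg0 : 0 <= \sum_k Bg k by apply: sumr_ge0 => k _; case: (BgP k).
have B0 : 0 <= B by exact: addr_ge0.
pose m := \sum_j \sum_p \sum_q `|tnth M j p q|.
have m0 : 0 <= m by do 3 apply: sumr_ge0 => ? _.
exists (d%:R * (m * B ^+ 2)); first by rewrite !mulr_ge0 ?exprn_ge0.
move=> h y Y yb [YE Yr] tau tau01.
have Pb z : 0 <= z <= 1 -> `|polyvec_eval Y z - ybar| <= r + 1.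
  move=> z01; have -> : polyvec_eval Y z - ybar = (polyvec_eval Y z - y) + (y - ybar).
    by rewrite addrA subrK.
  by apply: le_trans (ler_normD _ _) _; apply: lerD => //; exact/ltW/Yr.
apply: norm_mx_le; first by rewrite !mulr_ge0 ?exprn_ge0.
move=> i j; rewrite ord1 {j} mxE [X in _ + X]mxE (stage_eq_coord SH i YE tau01).
rewrite addrC addKr normrM mulrC; apply: ler_wpM2r => //.
apply: le_trans (ler_norm_sum _ _ _) _.
rewrite -[X in X%:R]card_ord mulr_natl -sumr_const; apply: ler_sum => k _.
apply: norm_Aform_le => //.
- exact/(continuous_gradient_path SH)/continuous_polyvec.
- move=> z z01; have [_ /(_ _ (Pb z z01))/le_trans] := BSP (i, k); apply.
  rewrite /B (bigD1 (i, k))//= -addrA lerDl addr_ge0// sumr_ge0// => ik _.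
  by case: (BSP ik).
- move=> z z01; have [_ /(_ _ (Pb z z01))/le_trans] := BgP k; apply.
  rewrite /B [X in _ + X](bigD1 k)//= addrCA lerDl addr_ge0// sumr_ge0// => l _.
  by case: (BgP l).
Qed.

Lemma energy_stage h y (Y : 'cV[{poly R}]_d) : (forall j, tnth M j = (tnth M j)^T) ->
  stage_eq M c S H h y Y -> H (polyvec_eval Y 1) = H y.
Proof.
move=> symM YE.
pose P := polyvec_eval Y.
pose mu (q : 'I_3) k := int01 (fun z => z ^+ q * gradient H (P z) k 0).
pose W tau : 'cV[R]_d := \col_i (y i 0 + h * \sum_k Aform M c tau
  (fun z => S (P z) i k) (fun z => gradient H (P z) k 0)).
(* [W] extends the right side of the stage equation beyond the unit interval: it agrees with [P]
   there, and its derivative has an explicit form at every real [t]. *)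
have WP tau : 0 <= tau <= 1 -> W tau = P tau.
  by move=> tau01; apply/colP => i; rewrite mxE (stage_eq_coord SH _ YE).
pose dW tau : 'cV[R]_d := \col_i (h * \sum_k \sum_(j < 3) \sum_(p < 3) \sum_(q < 3)
  tau ^+ p * (tnth M j p q * (S (P (tnth c j)) i k * mu q k))).
have WdW (t : R) : is_derive t (1 : R) W (dW t).
  apply: is_derive_mx => i j; rewrite ord1 mxE.
  rewrite (_ : (fun x => _) = cst (y i 0) + h \*: (fun x => \sum_k Aform M c x
      (fun z => S (P z) i k) (fun z => gradient H (P z) k 0))); last first.
    by apply/funext => x; rewrite mxE.
  rewrite -[X in is_derive _ _ _ X]add0r; apply: is_deriveD; apply: is_deriveZ.
  apply: is_derive_bigsum => k _; apply: is_derive_bigsum => l _.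
  apply: is_derive_bigsum => p _; apply: is_derive_bigsum => q _.
  set K := S _ _ _ * int01 _.
  rewrite (_ : (fun x => _) = (fun x => x ^+ p.+1 * (tnth M l p q * K / p.+1%:R))).
    exact: is_derive_monomial.
  by apply/funext => x; rewrite /K; move: (p.+1%:R^-1) => l'; ring.
have cW : continuous W.
  move=> t; apply: differentiable_continuous; apply/derivable1_diffP.
  by case: (WdW t).
have cP : continuous P by exact: continuous_polyvec.
have cdW i : continuous (fun t => dW t i 0).
  under eq_fun do rewrite mxE.
  apply: continuous_mulf; first exact: cst_continuous.
  do 4 apply: continuous_sum => ?.
  by apply: continuous_mulf; [exact: exprn_continuous|exact: cst_continuous].
have HW (t : R) : is_derive t (1 : R) (H \o W) (\sum_i dW t i 0 * gradient H (W t) i 0).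
  exact: (is_derive_comp_path (smooth_differentiable (W t) sH) (WdW t)).
have := int01_FTC HW; rewrite /= !WP ?lexx ?ler01//.
have -> : P 0 = y by exact: stage_eval0 YE.
have cf : continuous (fun t => \sum_i dW t i 0 * gradient H (W t) i 0).
  by apply: continuous_sum => i; apply: continuous_mulf;
    [exact: cdW|exact: @continuous_gradient_path _ _ _ _ SH W i cW].
move=> /(_ cf) E; apply/eqP; rewrite -subr_eq0 -{}E; apply/eqP.
transitivity (int01 (fun t => \sum_i \sum_k \sum_(j < 3) \sum_(p < 3) \sum_(q < 3)
    (h * (tnth M j p q * (S (P (tnth c j)) i k * mu q k))) *
    (t ^+ p * gradient H (P t) i 0))).
  apply: eq_int01 => t t01; rewrite WP//; apply: eq_bigr => i _.
  rewrite mxE mulr_sumr mulr_suml; apply: eq_bigr => k _.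
  rewrite mulr_sumr mulr_suml; apply: eq_bigr => j _.
  rewrite mulr_sumr mulr_suml; apply: eq_bigr => p _.
  rewrite mulr_sumr mulr_suml; apply: eq_bigr => q _; ring.
have cg (p : 'I_3) i : continuous (fun t : R => t ^+ p * gradient H (P t) i 0).
  by apply: continuous_mulf; [exact: exprn_continuous|exact: @continuous_gradient_path _ _ _ _ SH P i cP].
have cZ (k : R) (p : 'I_3) i :
    continuous (fun t : R => k * (t ^+ p * gradient H (P t) i 0)).
  by apply: continuous_mulf; [exact: cst_continuous|exact: cg].
pose X i k (j p q : 'I_3) := tnth M j p q * (S (P (tnth c j)) i k * mu q k) * mu p i.
transitivity (h * \sum_i \sum_k \sum_j \sum_p \sum_q X i k j p q).
  rewrite mulr_sumr int01_sum => [|i]; last by do 4 apply: continuous_sum => ?.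
  apply: eq_bigr => i _; rewrite mulr_sumr int01_sum => [|k]; last by do 3 apply: continuous_sum => ?.
  apply: eq_bigr => k _; rewrite mulr_sumr int01_sum => [|j]; last by do 2 apply: continuous_sum => ?.
  apply: eq_bigr => j _; rewrite mulr_sumr int01_sum => [|p]; last by apply: continuous_sum => ?.
  apply: eq_bigr => p _; rewrite mulr_sumr int01_sum => [|q]; last by [].
  by apply: eq_bigr => q _; rewrite int01Z; [rewrite /X -mulrA|exact: cg].
(* Exchanging [i] with [k] and [p] with [q] preserves the entry of the symmetric [M_j] and reverses
   the sign of the entry of the skew matrix, so the sum is its own opposite. *)
have XN : \sum_i \sum_k \sum_j \sum_p \sum_q X i k j p q =
    - \sum_i \sum_k \sum_j \sum_p \sum_q X i k j p q.
  rewrite [LHS]exchange_big -sumrN; apply: eq_bigr => i _; rewrite -sumrN.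
  apply: eq_bigr => k _; rewrite -sumrN; apply: eq_bigr => j _.
  rewrite [LHS]exchange_big -sumrN; apply: eq_bigr => p _; rewrite -sumrN.
  apply: eq_bigr => q _; rewrite /X.
  have -> : tnth M j q p = tnth M j p q by rewrite {1}symM mxE.
  have [_ _ /(_ (P (tnth c j)))/matrixP/(_ i k)] := SH; rewrite !mxE => ->.
  ring.
by apply/eqP; rewrite mulf_eq0; apply/orP; right; rewrite -eqNr; apply/eqP.
Qed.

Definition onem_polyvec (Y : 'cV[{poly R}]_d) : 'cV[{poly R}]_d :=
  \col_i (Y i 0 \Po (1 - 'X)).

Lemma onem_polyvec_eval Y tau : polyvec_eval (onem_polyvec Y) tau = polyvec_eval Y (1 - tau).
Proof. by apply/colP => i; rewrite !mxE horner_comp !hornerE. Qed.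

(** With [A] the sum of the bilinear forms, [Y_t = y - h A(t)]; hence [Y_(1 - tau) = Y_1 + h (A(1) -
    A(1 - tau))], and the hypothesis identifies the bracket with the form of the reflected curve. *)
Lemma stage_eq_onem h y Y :
  (forall tau (s g : R -> R), continuous g ->
    Aform M c tau (fun z => s (1 - z)) (fun z => g (1 - z)) =
    Aform M c 1 s g - Aform M c (1 - tau) s g) ->
  stage_eq M c S H (- h) y Y ->
  stage_eq M c S H h (polyvec_eval Y 1) (onem_polyvec Y).
Proof.
move=> AM YE; split=> [i|tau /andP[tau0 tau1]].
  rewrite mxE; have [Y4 _] := YE.
  have s2 : (size (1 - 'X : {poly R})%R <= 2)%N.
    rewrite (leq_trans (size_polyD _ _))// size_polyN size_polyX size_poly1.
    by [].
  apply: leq_trans (size_comp_poly_leq _ _) _; rewrite ltnS.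
  by apply: (@leq_trans (3 * 1)) => //; apply: leq_mul; rewrite -subn1 leq_subLR// Y4.
have cP : continuous (polyvec_eval Y) by exact: continuous_polyvec.
have cZ : continuous (polyvec_eval (onem_polyvec Y)) by exact: continuous_polyvec.
apply/colP => i; rewrite onem_polyvec_eval.
(* The sum is named so that rewriting never compares two of them up to
   conversion, which does not terminate in reasonable time. *)
have [X XE] : exists X, X = \sum_k Aform M c tau
    (fun z => S (polyvec_eval (onem_polyvec Y) z) i k)
    (fun z => gradient H (polyvec_eval (onem_polyvec Y) z) k 0) by eexists.
pose A t := \sum_k Aform M c t (fun z => S (polyvec_eval Y z) i k)
  (fun z => gradient H (polyvec_eval Y z) k 0).
have XA : X = A 1 - A (1 - tau).
  rewrite XE -sumrB; apply: eq_bigr => k _; rewrite -AM; last first.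
    exact: (@continuous_gradient_path _ _ _ _ SH _ k cP).
  by congr Aform; apply/funext => z; rewrite onem_polyvec_eval.
have YA t : 0 <= t <= 1 -> polyvec_eval Y t i 0 = y i 0 + - h * A t.
  exact: stage_eq_coord.
have := stage_rhs SH M c h tau (polyvec_eval Y 1) i cZ; rewrite -XE XA => ->.
rewrite !YA ?ler01 ?lexx ?subr_ge0 ?gerBl ?tau0 ?tau1//; ring.
Qed.

Variable Phi : R -> 'cV[R]_d -> 'cV[R]_d.
Hypothesis PhiP : pcsrk_method M c S H Phi.

Lemma pcsrk_near (ybar : 'cV[R]_d) : exists r e, [/\ 0 < r, 0 < e &
  forall h y, `|h| < e -> `|y - ybar| < e -> exists Y,
    [/\ near_stage M c S H r h y Y, forall Z, near_stage M c S H r h y Z -> Z = Y &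
      Phi h y = polyvec_eval Y 1]].
Proof.
have [r r0 [[A B] /= [nA nB] AB]] := PhiP ybar.
have [e1 /= e10 e1P] := (nbhs_ballP _ _).1 nA.
have [e2 /= e20 e2P] := (nbhs_ballP _ _).1 nB.
exists r, (Num.min e1 e2); split=> //; first by rewrite lt_min e10.
move=> h y; rewrite !lt_min => /andP[he1 _] /andP[_ ye2].
have [|Y [Y1 Y2 Y3]] := AB (h, y); first split=> /=.
- by apply: e1P; rewrite -ball_normE/= sub0r normrN.
- by apply: e2P; rewrite -ball_normE/= distrC.
by exists Y; split=> //; rewrite Y3; case: Y1 => /step_value_eval.
Qed.

Lemma pcsrk_energy_preserving : (forall j, tnth M j = (tnth M j)^T) ->
  energy_preserving H Phi.
Proof.
move=> symM y0; have [r [e [r0 e0 rP]]] := pcsrk_near y0.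
have y0e : `|y0 - y0| < e by rewrite subrr normr0.
near=> h; have he : `|h| < e by near: h; exact: near0_lt.
have [Y [[YE _] _ ->]] := rP h y0 he y0e.
exact: energy_stage symM YE.
Unshelve. all: by end_near. Qed.

Lemma pcsrk_symmetric :
  (forall tau (s g : R -> R), continuous g ->
    Aform M c tau (fun z => s (1 - z)) (fun z => g (1 - z)) =
    Aform M c 1 s g - Aform M c (1 - tau) s g) ->
  symmetric_method Phi.
Proof.
move=> AM ybar; have [r [e [r0 e0 rP]]] := pcsrk_near ybar.
have [C C0 CP] := near_stage_bound ybar r.
(* The bound 1 is for [near_stage_bound]; the bound [e / 2] leaves room for the first step to move
   the point. *)
pose e' := Num.min 1 (e / 2).
have e'0 : 0 < e' by rewrite lt_min ltr01 divr_gt0.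
(* This makes [C * |h|] smaller than [e / 2], so that [y'] stays within [e] of [ybar], and smaller
   than [r / 2], since two such displacements separate [Y_(1 - tau)] from [y']. *)
pose dl := Num.min e (Num.min (r / 2) (e / 2) / (C + 1)).
have C1 : 0 < C + 1 by rewrite ltr_wpDl.
have dl0 : 0 < dl.
  by rewrite lt_min e0 divr_gt0// lt_min !divr_gt0.
exists ([set h | `|h| < dl]%classic, [set y | `|y - ybar| < e']%classic).
  split => /=; first exact: near0_lt.
  by apply/nbhs_ballP; exists e' => // y; rewrite -ball_normE/= distrC.
move=> [h y] /= [hdl ye'].
have he : `|h| < e by move: hdl; rewrite lt_min => /andP[].
have [y1 ye] : `|y - ybar| < 1 /\ `|y - ybar| < e / 2.
  by move: ye'; rewrite lt_min => /andP[].
have Ch : C * `|h| < Num.min (r / 2) (e / 2).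
  move: hdl; rewrite lt_min => /andP[_]; rewrite ltr_pdivlMr// mulrC.
  by apply: le_lt_trans; rewrite ler_wpM2r// lerDl.
have [Chr Che] : C * `|h| < r / 2 /\ C * `|h| < e / 2.
  by move: Ch; rewrite lt_min => /andP[].
have [||Y [YN _ ->]] := rP (- h) y; first by rewrite normrN.
  by apply: lt_trans ye _; rewrite ltr_pdivrMr// ltr_pMr// ltr1n.
have Yb tau : 0 <= tau <= 1 -> `|polyvec_eval Y tau - y| <= C * `|h|.
  by move=> tau01; rewrite -[`|h|]normrN; exact: CP (ltW y1) YN tau tau01.
have YE := YN.1; set y' := polyvec_eval Y 1.
have ZE := stage_eq_onem AM YE.
have y'y : `|y' - y| <= C * `|h| by apply: Yb; rewrite ler01 lexx.
have ZN : near_stage M c S H r h y' (onem_polyvec Y).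
  split=> // tau /andP[tau0 tau1]; rewrite onem_polyvec_eval.
  have -> : polyvec_eval Y (1 - tau) - y' = (polyvec_eval Y (1 - tau) - y) - (y' - y).
    by rewrite opprB addrA subrK.
  apply: le_lt_trans (ler_normB _ _) _; rewrite [ltRHS]splitr.
  apply: ltrD; apply: le_lt_trans Chr => //.
  by apply: Yb; rewrite subr_ge0 tau1 gerBl tau0.
(* Uniqueness identifies the stage polynomial of the second step with the reflected one, whose value
   at 1 is [Y_0 = y]. *)
have [||Y' [_ /(_ _ ZN) <- ->]] := rP h y' => //.
  have -> : y' - ybar = (y' - y) + (y - ybar) by rewrite addrA subrK.
  apply: le_lt_trans (ler_normD _ _) _; rewrite [ltRHS]splitr.
  by apply: ltrD => //; exact: le_lt_trans Che.
by rewrite onem_polyvec_eval subrr (stage_eval0 SH YE).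
Qed.

End Method.

(** * Order four of the one-step map *)

Lemma pcsrk_order4 (R : realType) (d : nat) (S : 'cV[R]_d -> 'M[R]_d)
    (H : 'cV[R]_d -> R) (M : 3.-tuple 'M[R]_3) (c : 3.-tuple R)
    (Phi : R -> 'cV[R]_d -> 'cV[R]_d) :
  let p := Aform_defect M c in
  poisson_system S H -> (forall j, 0 <= tnth c j <= 1) -> pcsrk_method M c S H Phi ->
  (forall a b tau, (a + b < 2)%N -> p a b tau = 0) ->
  (forall a b tau, (a + b = 2)%N -> p a b (1 - tau) = - p a b tau) ->
  (forall a b, (a + b < 4)%N -> p a b 1 = 0) ->
  (forall W : R -> R, continuous W -> (forall tau, W (1 - tau) = - W tau) ->
    Aform M c 1 W (fun z => z ^+ 0) = 0) ->
  (forall W : R -> R, continuous W -> (forall tau, W (1 - tau) = - W tau) ->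
    Aform M c 1 (fun z => z ^+ 0) W = 0) ->
  order_at_least 4 S H Phi.
Proof.
move=> p SH c01 PhiP p_low p_anti p_at1 antil antir y0 y yP.
have [r [e [r0 e0 rP]]] := pcsrk_near PhiP y0.
(* A stage polynomial is chosen for every [h]; beyond the threshold it is the default 0, which
   estimates near 0 do not see. *)
have /choice[Y YP] h : exists Y, `|h| < e ->
    near_stage M c S H r h y0 Y /\ Phi h y0 = polyvec_eval Y 1.
  have [he|_] := ltP `|h| e; last by exists 0.
  have y0e : `|y0 - y0| < e by rewrite subrr normr0.
  by have [Y [YN _ YPhi]] := rP h y0 he y0e; exists Y.
have [C C0 CP] := near_stage_bound SH M c01 y0 r.
have YE : \forall h \near (0 : R), forall tau, 0 <= tau <= 1 -> forall i,
    polyvec_eval (Y h) tau i 0 = y0 i 0 + h * \sum_k Aform M c tau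
      (fun z => S (polyvec_eval (Y h) z) i k)
      (fun z => gradient H (polyvec_eval (Y h) z) k 0).
  near=> h => tau tau01 i; apply: stage_eq_coord => //.
  by have [|[]] := YP h; first by near: h; exact: near0_lt.
have YO : bigO01 1 (fun h tau => `|polyvec_eval (Y h) tau - y0|).
  exists C => //; near=> h => tau tau01; rewrite normr_id expr1.
  apply: CP => //; first by rewrite subrr normr0.
  by have [|] := YP h; first by near: h; exact: near0_lt.
have errO i : bigO01 5 (fun h _ => polyvec_eval (Y h) 1 i 0 - y h i 0).
  apply: (local_error SH yP c01 (Y := fun h => polyvec_eval (Y h))) => //.
  - by move=> h; exact: continuous_polyvec.
  - exact: YE.
  - exact: p_low.
  - exact: p_anti.
  - exact: p_at1.
  - exact: antil.
  - exact: antir.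
have [K K0 KP] : bigO01 5 (fun h _ => `|polyvec_eval (Y h) 1 - y h|).
  by apply: bigO01_cV => i; apply: bigO01_eq (errO i) => h _; rewrite !mxE.
apply/eqO_exP; exists (K + 1); first by rewrite ltr_wpDl.
near=> h; have he : `|h| < e by near: h; exact: near0_lt.
have [_ ->] := YP h he; apply: (@le_trans _ _ (K * `|h ^+ 5|)); last first.
  by rewrite ler_wpM2r// lerDl.
rewrite -[leLHS]normr_id normrX.
by apply: (near KP h _ 0); rewrite ?lexx ?ler01.
Unshelve. all: by end_near. Qed.

Theorem proposition3p1 (R : realType) (M1 M2 M3 : 'M[R]_3) (c1 c2 c3 : R)
  (c1_ge0 : 0 <= c1) (c12 : c1 < c2) (c23 : c2 < c3) (c3_le1 : c3 <= 1)
  (cond1 : [/\ M1 = M1^T, M2 = M2^T & M3 = M3^T])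
  (cond2 : exists alpha : R,
     mx_of_seq 3 3 [:: [:: 1;    2^-1; 3^-1];
                       [:: 2^-1; 3^-1; 4^-1];
                       [:: 3^-1; 4^-1; alpha]]
       *m (M1 + M2 + M3) = 1%:M)
  (cond3 :
     mx_of_seq 3 3 [:: [:: 1;  1;  1];
                       [:: 0; -1; -2];
                       [:: 0;  0;  1]]
       *m M3 *m
     mx_of_seq 3 3 [:: [:: 1;  0; 0];
                       [:: 1; -1; 0];
                       [:: 1; -2; 1]] = M1)
  (cond4 : c1 + c3 = 1 /\ c2 = 2^-1)
  (cond5 :
     (c1 *: M1 + c2 *: M2 + c3 *: M3)
       *m mx_of_seq 3 1 [:: [:: 1]; [:: 2^-1]; [:: 3^-1]]
     = mx_of_seq 3 1 [:: [:: 0]; [:: 1]; [:: 0]])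
  (cond6 :
     (mx_of_seq 1 3 [:: [:: 1; 2^-1; 3^-1]]
       *m (c1 ^+ 2 *: M1 + c2 ^+ 2 *: M2 + c3 ^+ 2 *: M3)
       *m mx_of_seq 3 1 [:: [:: 1]; [:: 2^-1]; [:: 3^-1]]) 0 0 = 3^-1)
  (d : nat) (S : 'cV[R]_d -> 'M[R]_d) (H : 'cV[R]_d -> R)
  (SH : poisson_system S H)
  (Phi : R -> 'cV[R]_d -> 'cV[R]_d)
  (PhiP : pcsrk_method [tuple M1; M2; M3] [tuple c1; c2; c3] S H Phi) :
  [/\ energy_preserving H Phi,
      symmetric_method Phi
    & order_at_least 4 S H Phi].
Proof.
have [alpha gramM] := cond2; have [c13 c2E] := cond4; have [M1T M2T M3T] := cond1.
pose M := [tuple M1; M2; M3]; pose c := [tuple c1; c2; c3].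
have c01 j : 0 <= tnth c j <= 1.
  by elim/ord3P: j; rewrite (tnth_nth 0)/=; lra.
have symM j : tnth M j = (tnth M j)^T by elim/ord3P: j; rewrite (tnth_nth 0).
(* The right factor in the third condition is the transpose of the left one. *)
have onemM : onem_mx R *m M3 *m (onem_mx R)^T = M1.
  rewrite -[RHS]cond3; congr (_ *m _).
  by apply/matrixP; apply: ord3P; apply: ord3P; rewrite !mxE.
split.
- by apply: (pcsrk_energy_preserving SH PhiP).
- apply: (pcsrk_symmetric SH c01 PhiP).
  exact: (Aform_onem gramM onemM c13 c2E).
- apply: (pcsrk_order4 SH c01 PhiP).
  + exact: (Aform_exact_low gramM cond5).
  + exact: (Aform_defect_onem cond1 gramM onemM c13 c2E cond5 cond6).
  + exact: (Aform_exact1 cond1 gramM onemM c13 c2E cond5 cond6).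
  + by move=> W _; exact: (Aform_antisym_l gramM onemM c13 c2E).
  + exact: (Aform_antisym_r gramM onemM c13 c2E).
Qed.
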